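(* Let $r\ge 3$ be an integer, let $0<a<b<\frac{r-1}{r}$, and let $k=k(n)$ be integers satisfying $a\le\frac{k}{n}\le b$. For each $n$, let $\mathcal A_1,\dots,\mathcal A_r\subseteq\binom{[n]}{k}$ be $r$-cross-intersecting families (depending on $n$). If, as $n\to\infty$, $$\prod_{i=1}^r\frac{|\mathcal A_i|}{\binom nk}\ge (1-o(1))\left(\frac kn\right)^r,$$ then there exists $j=j(n)\in[n]$ such that, for every $i\in[r]$, $$\frac{|\mathcal A_i\,\Delta\,\mathcal S_j^{(k)}|}{\binom{n-1}{k-1}}=o(1)\qquad (n\to\infty).$$
   Context: $[n]=\{1,\dots,n\}$ and $\binom{[n]}{k}$ is the set of $k$-element subsets of $[n]$. Families $\mathcal A_1,\dots,\mathcal A_r$ of subsets of $[n]$ are $r$-cross-intersecting if $A_1\cap\cdots\cap A_r\neq\varnothing$ for every choice of $A_i\in\mathcal A_i$, $i\in[r]$. For $j\in[n]$, $\mathcal S_j^{(k)}=\{A\in\binom{[n]}{k}: j\in A\}$. $\Delta$ denotes symmetric difference. $o(1)$ denotes a quantity tending to $0$ as $n\to\infty$, with $r,a,b$ fixed. *)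

(* Defs.v *)
From mathcomp Require Import all_boot.

Set Implicit Arguments.
Unset Strict Implicit.
Unset Printing Implicit Defensive.

(* The ground set [n] = {1, ..., n} is rendered by 'I_n = {0, ..., n-1}. *)

Definition ksubsets (n k : nat) : {set {set 'I_n}} :=
  [set B : {set 'I_n} | #|B| == k].

Definition cross_intersecting (n r : nat) (A : 'I_r -> {set {set 'I_n}}) : Prop :=
  forall B : 'I_r -> {set 'I_n},
    (forall i, B i \in A i) -> (\bigcap_(i < r) B i)%SET != set0.

(* The index j is a natural number rather than an element of 'I_n, because
   'I_0 is empty and so there is no sequence of type forall n, 'I_n.
   It is only meaningful for j < n (otherwise the star is empty). *)
Definition star (n k j : nat) : {set {set 'I_n}} :=
  [set B in ksubsets n k | [exists x in B, val x == j]].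

Definition symdiff (T : finType) (A B : {set T}) : {set T} :=
  (A :\: B) :|: (B :\: A).

(* Main.v *)
(* Let q = (r-1)/r, let U_i be the up-closure of A_i, and let mu_p be the p-biased
   measure. A uniformly random colouring g of [n] with r colours makes each set
   {g <> i} q-biased; these sets have empty intersection, so at least one of them
   misses its U_i. Hence the sum of the mu_q(U_i) is at most r - 1. By convexity of
   t^c and induction on the coordinates, mu_(q^c)(U) <= mu_q(U)^c for every up-set U
   and c >= 1. With p = q^c slightly above k/n, Chebyshev's inequality and LYM bound
   |A_i| / binom(n,k) by mu_p(U_i) up to o(1); by AM-GM, the assumption on the product
   forces the sum of the mu_q(U_i) to be (1-o(1))(r-1). Thus for almost all colourings
   exactly one colour i is missed, and whether i is missed depends on the class
   {g = i} only and is monotone in it. As there are at least three colours, the missed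
   colour is almost always g(j) for one fixed point j, so that U_i has almost no
   element avoiding j. The same then holds for A_i, and the sizes follow from the
   product. *)
Require Import Defs.
From mathcomp Require Import all_boot all_order all_algebra.
From mathcomp Require Import perm.
From mathcomp Require Import ring lra zify.
Import Order.TTheory GRing.Theory Num.Theory.

Set Implicit Arguments.
Unset Strict Implicit.
Unset Printing Implicit Defensive.

(** * Families of predicates on colourings *)

Section Colourings.
Variables (T C : finType).
Local Notation col := {ffun T -> C}.
Implicit Types (g h k l : col) (S : {set T}).

Definition mix S g h : col := [ffun t => if t \in S then g t else h t].

(** An injective map on the finite type [C * C] is bijective, so acting with [s t] at every point
    [t] permutes the pairs of colourings: the recoloured pair is again uniform. *)
Lemma sum_pair_coupling (s : T -> C * C -> C * C)
    (F : col -> col -> nat) :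
  (forall t, injective (s t)) ->
  \sum_(g : col) \sum_(h : col) F [ffun t => (s t (g t, h t)).1] [ffun t => (s t (g t, h t)).2]
    = \sum_(g : col) \sum_(h : col) F g h.
Proof.
move=> s_inj; rewrite !pair_big /=.
pose psi (p : col * col) : col * col :=
  ([ffun t => (s t (p.1 t, p.2 t)).1], [ffun t => (s t (p.1 t, p.2 t)).2]).
have psi_inj : injective psi.
  move=> [g h] [g' h'] [/ffunP e1 /ffunP e2].
  have e t : (g t, h t) = (g' t, h' t).
    apply: (s_inj t); move: (e1 t) (e2 t); rewrite !ffunE /=.
    by case: (s t _) => ? ?; case: (s t _) => ? ? /= -> ->.
  by congr (_, _); apply/ffunP => t; case: (e t).
by rewrite [RHS](reindex_inj psi_inj).
Qed.

Lemma sum_coupling (s : T -> C * C -> C * C) (F : col -> nat) :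
  (forall t, injective (s t)) ->
  \sum_(g : col) \sum_(h : col) F [ffun t => (s t (g t, h t)).1] = #|col| * \sum_(g : col) F g.
Proof.
move=> s_inj; rewrite (sum_pair_coupling (fun g _ => F g) s_inj) big_distrr /=.
by apply: eq_bigr => g _; rewrite sum_nat_const.
Qed.

Lemma sum_pair_mix S (F : col -> col -> nat) :
  \sum_(g : col) \sum_(h : col) F (mix S g h) (mix S h g) = \sum_(g : col) \sum_(h : col) F g h.
Proof.
pose s t (p : C * C) := if t \in S then p else (p.2, p.1).
rewrite -[RHS](sum_pair_coupling (s := s)); last first.
  by move=> t [a b] [a' b']; rewrite /s; case: ifP => _ [-> ->].
apply: eq_bigr => g _; apply: eq_bigr => h _.
by congr F; apply/ffunP => t; rewrite !ffunE /s; case: ifP.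
Qed.

Lemma sum_mix S (F : col -> nat) :
  \sum_(g : col) \sum_(h : col) F (mix S g h) = #|col| * \sum_(g : col) F g.
Proof.
rewrite (sum_pair_mix S (fun g _ => F g)) big_distrr /=.
by apply: eq_bigr => g _; rewrite sum_nat_const.
Qed.

Lemma sum_colour_at j c :
  #|C| * \sum_(g : col) (g j == c) = #|col|.
Proof.
have -> : \sum_(g : col) (g j == c)
    = #|family (fun t : T => if t == j then pred1 c else predT)|.
  rewrite -sum1_card [RHS]big_mkcond; apply: eq_bigr => g _ /=.
  suff -> : (g \in family (fun t : T => if t == j then pred1 c else predT)) = (g j == c).
    by case: eqP.
  apply/familyP/eqP => [/(_ j)|e t]; first by rewrite eqxx inE => /eqP.
  by case: eqP => // ->; rewrite inE e.
rewrite card_family card_ffun foldrE big_map big_enum (bigD1 j) //= eqxx card1 mul1n.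
rewrite (eq_bigr (fun=> #|C|)); last by move=> t /negPf ->.
rewrite prod_nat_const (_ : #|(fun i : T => i != j)| = #|T|.-1); last exact: cardC1.
by rewrite -expnS prednK //; apply/card_gt0P; exists j.
Qed.

Section Predicate.
Variable f : pred col.

(** Up to the factor [#|col| ^ 2], this is the influence of the coordinate set [S]: the probability
    that re-randomising the colours on [S] changes [f]. *)
Definition dependence S := \sum_(g : col) \sum_(h : col) (f g != f (mix S h g)).

(** Failure of additivity on the 2 x 2 table whose rows are [g], [h] on [S] and whose columns are
    [g], [h] off [S]. *)
Definition interaction S g h :=
  f g + f h != f (mix S h g) + f (mix S g h).

(* The 3 x 3 table with rows g, h, k on S and columns g, k, l off S would be
   additive, and no additive 0-1 table depends on both its row and its column. *)
Lemma dependence_mul_le S :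
  dependence S * dependence (~: S)
    <= 3 * #|col| ^ 2 * \sum_(g : col) \sum_(h : col) interaction S g h.
Proof.
set N := #|_|; set B := \sum_(g : col) _.
pose i1 g h k (l : col) := nat_of_bool (interaction S g (mix S h k)).
pose i2 g h (k : col) l := nat_of_bool (interaction S g (mix S h l)).
pose i3 g (h : col) k l := nat_of_bool (interaction S k (mix S g l)).
have mixl g h k : mix S (mix S g h) k = mix S g k.
  by apply/ffunP => t; rewrite !ffunE; case: (t \in S).
have mixr g h k : mix S g (mix S h k) = mix S g k.
  by apply/ffunP => t; rewrite !ffunE; case: (t \in S).
have mixC g h : mix (~: S) g h = mix S h g.
  by apply/ffunP => t; rewrite !ffunE inE; case: (t \in _).
(* Without interactions, the jump from row [g] to row [h] has the same nonzero value in columns [g],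
   [k] and [l], so row [g] has equal entries in columns [k] and [l]; but the third table carries the
   change from column [k] to column [l] over from row [k] to row [g]. *)
have le g h k l : (f g != f (mix S h g)) * (f k != f (mix (~: S) l k))
    <= i1 g h k l + i2 g h k l + i3 g h k l.
  rewrite /i1 /i2 /i3 /interaction !mixl !mixr mixC.
  move: (f g) (f (mix S h g)) (f k) (f (mix S k l)) (f (mix S h k))
    (f (mix S g k)) (f (mix S h l)) (f (mix S g l)).
  by do 8!case.
have -> : dependence S * dependence (~: S) = \sum_(g : col) \sum_(h : col) \sum_(k : col) \sum_l
    (f g != f (mix S h g)) * (f k != f (mix (~: S) l k)).
  rewrite /dependence big_distrl; apply: eq_bigr => g _.
  rewrite big_distrl; apply: eq_bigr => h _.
  rewrite big_distrr; apply: eq_bigr => k _.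
  by rewrite big_distrr.
apply: (@leq_trans (\sum_(g : col) \sum_(h : col) \sum_(k : col) \sum_l
    (i1 g h k l + i2 g h k l + i3 g h k l))).
  by do 4!(apply: leq_sum => ? _); exact: le.
have e1 : \sum_(g : col) \sum_(h : col) \sum_(k : col) \sum_(l : col) i1 g h k l = N ^ 2 * B.
  rewrite big_distrr; apply: eq_bigr => g _ /=.
  rewrite -mulnA -(sum_mix S (fun h => interaction S g h)) big_distrr.
  apply: eq_bigr => h _; rewrite big_distrr; apply: eq_bigr => k _.
  by rewrite sum_nat_const.
have e2 : \sum_(g : col) \sum_(h : col) \sum_(k : col) \sum_(l : col) i2 g h k l = N ^ 2 * B.
  rewrite -e1; apply: eq_bigr => g _; apply: eq_bigr => h _.
  by rewrite exchange_big.
have e3 : \sum_(g : col) \sum_(h : col) \sum_(k : col) \sum_(l : col) i3 g h k l = N ^ 2 * B.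
  transitivity (\sum_(h : col) \sum_(k : col) \sum_(g : col) \sum_(l : col) i3 g h k l).
    by rewrite exchange_big /=; apply: eq_bigr => h _; rewrite exchange_big.
  rewrite /i3 sum_nat_const expnS expn1 -mulnA; congr (_ * _); rewrite big_distrr.
  by apply: eq_bigr => k _; exact: (sum_mix S (fun h => interaction S k h)).
have split4 (F1 F2 : col -> col -> col -> col -> nat) :
    \sum_g \sum_h \sum_k \sum_l (F1 g h k l + F2 g h k l)
    = \sum_g \sum_h \sum_k \sum_l F1 g h k l + \sum_g \sum_h \sum_k \sum_l F2 g h k l.
  by do 3!(rewrite -big_split; apply: eq_bigr => ? _ /=); rewrite big_split.
by rewrite split4 split4 e1 e2 e3; lia.
Qed.

(** Recolour [S1] first and [S2] second. By [sum_pair_mix] the intermediate colouring and its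
    counterpart are again a uniform pair, so the second stage is measured by [dependence S2]. *)
Lemma dependenceU S1 S2 : [disjoint S1 & S2] ->
  dependence (S1 :|: S2) <= dependence S1 + dependence S2.
Proof.
move=> dis; rewrite /dependence -[X in _ + X](sum_pair_mix (~: S1)).
rewrite -big_split; apply: leq_sum => g _; rewrite -big_split; apply: leq_sum => h _ /=.
have -> : mix (~: S1) g h = mix S1 h g by apply/ffunP => t; rewrite !ffunE inE; case: (t \in S1).
have -> : mix S2 (mix (~: S1) h g) (mix S1 h g) = mix (S1 :|: S2) h g.
  apply/ffunP => t; rewrite !ffunE !inE.
  case t1: (t \in S1) => /=; first by rewrite (disjointFr dis t1).
  by case: (t \in S2).
by move: (f g) (f (mix S1 h g)) (f (mix (S1 :|: S2) h g)) => [] [] [].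
Qed.

Lemma dependence0 : dependence set0 = 0.
Proof.
rewrite /dependence big1 // => g _; rewrite big1 // => h _.
by rewrite (_ : mix set0 h g = g) ?eqxx //; apply/ffunP => t; rewrite !ffunE inE.
Qed.

Lemma dependenceT :
  dependence setT = 2 * ((\sum_(g : col) f g) * (\sum_(g : col) ~~ f g)).
Proof.
rewrite /dependence.
transitivity (\sum_(g : col) \sum_(h : col) (f g * ~~ f h + ~~ f g * f h)).
  apply: eq_bigr => g _; apply: eq_bigr => h _.
  rewrite (_ : mix setT h g = h); first by case: (f g); case: (f h).
  by apply/ffunP => t; rewrite !ffunE inE.
rewrite mul2n -addnn {2}mulnC !big_distrl -big_split; apply: eq_bigr => g _ /=.
by rewrite !big_distrr -big_split.
Qed.

End Predicate.

(* For independent uniform colours (c, d), the first components of [recolour] and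
   [recolour'] are uniform, equal i exactly when c (resp. d) does, and agree as
   regards every colour other than i and a. The second components only serve to
   make both maps bijective. *)
Definition recolour (i a : C) (p : C * C) : C * C :=
  if p.1 == i then (i, p.2) else if p.2 == i then (a, p.1)
  else if p.1 != a then (p.1, p.2) else (p.2, i).

Definition recolour' (i a : C) (p : C * C) : C * C :=
  if p.2 == i then (i, p.1) else if p.1 == i then (a, p.2)
  else if p.1 != a then (p.1, p.2) else (p.2, i).

Lemma recolour_inj i a : a != i -> injective (recolour i a).
Proof.
move=> /eqP ai [c d] [c' d']; rewrite /recolour /=.
case: (c =P i) => ?; case: (d =P i) => ?; case: (c =P a) => ?;
case: (c' =P i) => ?; case: (d' =P i) => ?; case: (c' =P a) => ? /= [] *; congruence.
Qed.

Lemma recolour'_inj i a : a != i -> injective (recolour' i a).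
Proof.
move=> /eqP ai [c d] [c' d']; rewrite /recolour' /=.
case: (c =P i) => ?; case: (d =P i) => ?; case: (c =P a) => ?;
case: (c' =P i) => ?; case: (d' =P i) => ?; case: (c' =P a) => ? /= [] *; congruence.
Qed.

Lemma recolour_eq_main i a p : a != i -> ((recolour i a p).1 == i) = (p.1 == i).
Proof.
move=> /eqP ai; case: p => c d; rewrite /recolour /=.
by apply/eqP/eqP; case: (c =P i) => ?; case: (d =P i) => ?; case: (c =P a) => ? /=;
  congruence.
Qed.

Lemma recolour'_eq_main i a p : a != i -> ((recolour' i a p).1 == i) = (p.2 == i).
Proof.
move=> /eqP ai; case: p => c d; rewrite /recolour' /=.
by apply/eqP/eqP; case: (c =P i) => ?; case: (d =P i) => ?; case: (c =P a) => ? /=;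
  congruence.
Qed.

Lemma recolour_eq_other i a c p : c != i -> c != a ->
  ((recolour i a p).1 == c) = ((recolour' i a p).1 == c).
Proof.
move=> /eqP ci /eqP ca; case: p => d e; rewrite /recolour /recolour' /=.
by apply/eqP/eqP; case: (d =P i) => ?; case: (e =P i) => ?; case: (d =P a) => ? /=;
  congruence.
Qed.

(** * Monotone predicates covering all colourings *)

Section Cover.
Variable f : C -> pred col.
Hypothesis f_mono : forall c g h,
  (forall t, g t == c -> h t == c) -> f c g -> f c h.
Hypothesis f_cover : forall g, exists c, f c g.

Definition overfull g := 1 < \sum_c f c g.

Lemma f_local c g h : (forall t, (g t == c) = (h t == c)) -> f c g = f c h.
Proof. by move=> e; apply/idP/idP; apply: f_mono => t; rewrite e. Qed.

Lemma cover_sum g : 1 + overfull g <= \sum_c f c g.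
Proof.
rewrite /overfull; case: leqP => //= le1; have [c fc] := f_cover g.
by rewrite addn0 (bigD1 c) //= fc.
Qed.

(* Recolour with (i, a) on S and with (i, b) off S: every colour c other than i keeps
   its class under the change of rows or under the change of columns. Where exactly
   one predicate holds, the one of colour i is therefore additive. *)
Lemma interaction_le i a b S : a != i -> b != i -> a != b ->
  \sum_(g : col) \sum_(h : col) interaction (f i) S g h
    <= 4 * #|col| * \sum_(g : col) overfull g.
Proof.
move=> ai bi ab.
(* The bits [u] and [v] say whether the primed recolouring is used on [S] and off [S]. As far as
   colour [i] is concerned, the four colourings [G u v g h] realise the 2 x 2 table of [g] and [h];
   this is [fi]. *)
pose s (u v : bool) t := if t \in S then (if u then recolour' i a else recolour i a)
  else (if v then recolour' i b else recolour i b).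
have s_inj u v t : injective (s u v t).
  rewrite /s; case: (t \in S); case: u; case: v => p q;
    by [exact: recolour_inj | exact: recolour'_inj].
pose G u v g h : col := [ffun t => (s u v t (g t, h t)).1].
have fi u v g h : f i (G u v g h) = f i (mix S (if u then h else g) (if v then h else g)).
  apply: f_local => t; rewrite !ffunE /s.
  by case: (t \in S); case: u; case: v; rewrite ?recolour_eq_main ?recolour'_eq_main.
have mixx g : mix S g g = g by apply/ffunP => t; rewrite ffunE if_same.
have fc g h c : c != i -> f c (G false false g h) + f c (G true true g h)
    = f c (G true false g h) + f c (G false true g h).
  move=> ci; have [ca|ca] := eqVneq c a.
    rewrite addnC (_ : f c (G true true g h) = f c (G true false g h)); last first.
      apply: f_local => t; rewrite !ffunE /s; case: (t \in S) => //.
      by rewrite recolour_eq_other // ca.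
    congr (_ + nat_of_bool _); apply: f_local => t; rewrite !ffunE /s.
    by case: (t \in S) => //; rewrite recolour_eq_other // ca.
  congr (nat_of_bool _ + nat_of_bool _); apply: f_local => t; rewrite !ffunE /s;
    by case: (t \in S) => //; rewrite recolour_eq_other.
have le g h : interaction (f i) S g h <= overfull (G false false g h)
    + overfull (G true false g h) + overfull (G false true g h) + overfull (G true true g h).
  have := cover_sum (G false false g h); have := cover_sum (G true true g h).
  have := cover_sum (G true false g h); have := cover_sum (G false true g h).
  rewrite /interaction /overfull !(bigD1 (P := xpredT) i) //= !fi /= !mixx.
  have : \sum_(c | c != i) (f c (G false false g h) + f c (G true true g h))
    = \sum_(c | c != i) (f c (G true false g h) + f c (G false true g h)).
    exact: eq_bigr (fc g h).
  rewrite !big_split /=; case: eqP => //= ?.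
  by do 4!case: leqP => /=; lia.
apply: (@leq_trans (\sum_(g : col) \sum_(h : col) (overfull (G false false g h)
    + overfull (G true false g h) + overfull (G false true g h)
    + overfull (G true true g h)))).
  by do 2!(apply: leq_sum => ? _); exact: le.
have e u v : \sum_(g : col) \sum_(h : col) overfull (G u v g h)
    = #|col| * \sum_(g : col) overfull g by exact: sum_coupling.
have split2 (F1 F2 : col -> col -> nat) : \sum_g \sum_h (F1 g h + F2 g h)
    = \sum_g \sum_h F1 g h + \sum_g \sum_h F2 g h.
  by rewrite -big_split; apply: eq_bigr => g _; rewrite big_split.
by rewrite !split2 !e; lia.
Qed.
End Cover.
End Colourings.

(* Remove a point from a minimal set on which phi exceeds tau. *)
Lemma threshold_coordinate (T : finType) (R : realDomainType) (phi : {set T} -> R) (tau : R) :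
    (phi set0 <= tau)%R ->
    (forall S1 S2 : {set T}, [disjoint S1 & S2] -> (phi (S1 :|: S2) <= phi S1 + phi S2)%R) ->
    (forall S, (phi S <= tau)%R \/ (phi (~: S) <= tau)%R) ->
    (tau < phi setT)%R ->
  exists j, (phi (~: [set j]) <= tau + tau)%R.
Proof.
move=> phi0 phiU phiC phiT.
case: (@arg_minnP _ setT (fun S => (tau < phi S)%R) (fun S : {set T} => #|S|) phiT) => S St Smin.
have [j jS] : exists j, j \in S.
  by apply/set0Pn; apply: contraTneq St => ->; rewrite -leNgt.
exists j; have -> : ~: [set j] = (S :\ j) :|: ~: S.
  by apply/setP => t; rewrite !inE; case: eqP => [->|_]; rewrite ?jS //= orbN.
apply: le_trans (phiU _ _ _) _.
  by rewrite -setI_eq0; apply/eqP/setP => t; rewrite !inE; case: (t \in S); rewrite ?andbF.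
(* [phi S] exceeds [tau], so the dichotomy bounds [phi (~: S)]; minimality of [S] bounds
   [phi (S :\ j)]. *)
apply: lerD; last by case: (phiC S) => //; rewrite leNgt St.
rewrite leNgt; apply/negP => /Smin; rewrite (cardsD1 j S) jS; lia.
Qed.

(** * Nearly exact covers are close to dictators *)

Section RobustDictator.
Variables (R : realFieldType) (T C : finType).
Local Notation col := {ffun T -> C}.
Variable f : C -> pred col.
Hypothesis f_mono : forall c (g h : col),
  (forall t, g t == c -> h t == c) -> f c g -> f c h.
Hypothesis f_cover : forall g : col, exists c, f c g.

(** Some colour [c'] other than [i] and [c] holds at [g]. Exchanging [i] and [c] leaves the class of
    [c'] alone and gives [j] the colour [i], so both [i] and [c'] hold at [g']. This transfers the
    approximation from colour [i] to the others. *)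
Lemma overfull_swap (i c : C) j (g : col) (g' := [ffun t => tperm i c (g t)] : col) :
  c != i -> g j = c -> ~~ f c g ->
  f i g = (g j == i) -> f i g' = (g' j == i) -> overfull f g'.
Proof.
move=> ci gj nfc; rewrite gj (negPf ci) => fig.
rewrite /g' ffunE gj tpermR eqxx => fig'.
have [c' fc'] := f_cover g.
have c'i : c' != i by apply: contraTneq fc' => ->; rewrite fig.
have c'c : c' != c by apply: contraTneq fc' => ->.
rewrite /overfull (bigD1 i) //= fig' (bigD1 c') //= (_ : f c' _ = true) //.
rewrite -fc'; apply: f_local => // t; rewrite ffunE.
by rewrite -(inj_eq (@perm_inj _ (tperm i c))) tpermK tpermD // eq_sym.
Qed.

(** Few interactions force one of any two complementary sets to have small influence, while [c0] and
    [c1] keep the total influence large; [threshold_coordinate] then isolates a point [j] whose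
    complement has little influence. Monotonicity brings [f i] close to [g j == i], and swapping
    colours treats the rest. *)
Theorem robust_dictator (i : C) (c0 c1 : R) :
    (2 < #|C|)%N -> T ->
    (0 < c0)%R -> (0 < c1)%R ->
    (c1 * #|{: col}|%:R <= (\sum_(g : col) f i g)%:R)%R ->
    (c0 * #|{: col}|%:R <= (\sum_(g : col) ~~ f i g)%:R)%R ->
  exists j, forall c, ((\sum_(g : col) ((g j == c) && ~~ f c g))%:R
    <= 49 / (c0 * c1) ^+ 2 * (\sum_(g : col) overfull f g)%:R :> R)%R.
Proof.
move=> C_gt2 t0 c0_gt0 c1_gt0.
set N := #|_|; set x := \sum_g _; set y := \sum_g _; set B := \sum_g _ => hx hy.
have xyN : x + y = N.
  by rewrite -big_split /N -sum1_card /=; apply: eq_bigr => g _; case: f.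
have N_gt0 : (0 < N%:R :> R)%R.
  by rewrite ltr0n; apply/card_gt0P; exists [ffun=> i].
have c01 : (c0 + c1 <= 1)%R.
  have := lerD hy hx.
  by rewrite -natrD addnC xyN -mulrDl -[leRHS]mul1r ler_pM2r.
have [a [b [ai [bi ab]]]] : exists a b : C, a != i /\ b != i /\ a != b.
  have : 1 < #|[set~ i]| by rewrite cardsC1; case: #|C| C_gt2 => // -[].
  by move=> /card_gt1P[a [b []]]; rewrite !inE => ai bi ab; exists a, b.
pose dep S : R := ((dependence (f i) S)%:R)%R.
have depM S : (dep S * dep (~: S) <= 12 * N%:R ^+ 3 * B%:R)%R.
  rewrite /dep -natrX -!natrM ler_nat.
  apply: leq_trans (dependence_mul_le _ _) _.
  have leI := interaction_le f_mono f_cover S ai bi ab; rewrite -/N -/B in leI.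
  apply: (leq_trans (leq_mul (leqnn (3 * N ^ 2)) leI)); lia.
(* [tau] turns the bound in [depM] into [tau * (K * N%:R ^+ 2)], where [K * N%:R ^+ 2] is half of
   the lower bound [depT]. If [dep S] and [dep (~: S)] both exceeded [tau], one would be at least
   that half, and the product would be too large. *)
pose K := (c0 * c1)%R; pose tau := (12 * N%:R * B%:R / K)%R.
have K_gt0 : (0 < K)%R by exact: mulr_gt0.
have tauK : (tau * K = 12 * N%:R * B%:R)%R by rewrite /tau divfK // gt_eqF.
have tau_ge0 : (0 <= tau)%R by rewrite divr_ge0 ?mulr_ge0 ?ler0n // ltW.
have depT : (2 * K * N%:R ^+ 2 <= dep setT)%R.
  rewrite /dep dependenceT -/x -/y !natrM.
  have := ler_pM (mulr_ge0 (ltW c1_gt0) (ltW N_gt0)) (mulr_ge0 (ltW c0_gt0) (ltW N_gt0)) hx hy.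
  rewrite /K; nra.
have K_le1 : (K <= 1)%R by rewrite /K; nra.
have sum_le j c : ((\sum_(g : col) ((g j == c) && ~~ f c g))%:R <= N%:R :> R)%R.
  by rewrite ler_nat /N -sum1_card; apply: leq_sum => g _; exact: leq_b1.
have K2_gt0 : (0 < K ^+ 2)%R by exact: exprn_gt0.
(* If [tau] is not below the total influence, [B] is so large that the trivial bound [sum_le] is
   enough, whatever the point. *)
have [tau_lt|tau_ge] := ltP tau (dep setT); last first.
  exists t0 => c; apply: le_trans (sum_le t0 c) _.
  rewrite mulrAC ler_pdivlMr // -/K.
  have : (2 * K * N%:R ^+ 2 * K <= 12 * N%:R * B%:R)%R.
    by rewrite -tauK ler_pM2r //; exact: le_trans depT tau_ge.
  have -> : (2 * K * N%:R ^+ 2 * K = N%:R * (2 * K ^+ 2 * N%:R))%R by ring.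
  have -> : (12 * N%:R * B%:R = N%:R * (12 * B%:R) :> R)%R by ring.
  by rewrite ler_pM2l //; have := ler0n R B; lra.
have [j hj] : exists j, (dep (~: [set j]) <= tau + tau)%R.
  apply: threshold_coordinate => //.
  - by rewrite /dep dependence0.
  - by move=> S1 S2 dis; rewrite /dep -natrD ler_nat dependenceU.
  move=> S; apply/orP; rewrite -[_ || _]negbK negb_or -!ltNge; apply/negP => /andP[lt1 lt2].
  have : (2 * K * N%:R ^+ 2 <= dep S + dep (~: S))%R.
    apply: le_trans depT _; rewrite /dep -natrD ler_nat -(setUCr S) dependenceU //.
    by rewrite -setI_eq0 setICr.
  have := depM S; have e : (12 * N%:R ^+ 3 * B%:R = tau * (K * N%:R ^+ 2))%R.
    by rewrite [RHS]mulrA tauK; ring.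
  rewrite e; have : (0 < K * N%:R ^+ 2)%R by rewrite mulr_gt0 ?exprn_gt0.
  rewrite -mulrA; move: (K * N%:R ^+ 2)%R => W W_gt0 le1 le2.
  have [le3|le3] : (W <= dep S)%R \/ (W <= dep (~: S))%R by lra.
    have : (tau * W < dep S * dep (~: S))%R; last by lra.
    rewrite mulrC; apply: le_lt_trans (ler_wpM2r tau_ge0 le3) _.
    by rewrite ltr_pM2l // (lt_le_trans W_gt0).
  have : (tau * W < dep S * dep (~: S))%R; last by lra.
  apply: le_lt_trans (ler_wpM2l tau_ge0 le3) _.
  by rewrite ltr_pM2r // (lt_le_trans W_gt0).
exists j => c; rewrite -/K.
set X0 := \sum_(g : col) ((g j == i) && ~~ f i g).
pose X1 := \sum_(g : col) ((g j != i) && f i g).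
(* For an error [g] counted by [X0] and an [h] with [f i h], replacing [g] by [h] off [j] keeps
   colour [i] at [j], so the class of [i] contains that of [h] and [f i] becomes true. Such pairs
   are counted in [dep (~: [set j])]; [leX1] is dual. *)
have leX0 : (X0%:R * x%:R <= tau + tau)%R.
  apply: le_trans hj; rewrite /dep -natrM ler_nat big_distrl; apply: leq_sum => g _ /=.
  rewrite big_distrr; apply: leq_sum => h _ /=.
  case: eqP => //= gj; case fg: (f i g) => //=; case fh: (f i h) => //=.
  rewrite (f_mono _ fh) // => t ht; rewrite ffunE !inE.
  by case: (t =P j) => [->|] //=; rewrite gj.
have leX1 : (X1%:R * y%:R <= tau + tau)%R.
  apply: le_trans hj; rewrite /dep -natrM ler_nat big_distrl; apply: leq_sum => g _ /=.
  rewrite big_distrr; apply: leq_sum => h _ /=.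
  case: eqP => //= gj; case fg: (f i g) => //=; case fh: (f i h) => //=.
  case fm: (f i _) => //; rewrite (f_mono _ fm) // in fh => t.
  by rewrite ffunE !inE; case: (t =P j) => [->|] //= /eqP.
pose E := \sum_(g : col) (f i g != (g j == i)).
have EX : E = X0 + X1.
  by rewrite -big_split; apply: eq_bigr => g _ /=; case: (g j == i); case: (f i g).
have hE : (E%:R <= 24 / K ^+ 2 * B%:R)%R.
  (* Dividing by [c1] or [c0] costs a factor [c0 / K] or [c1 / K]; the two errors sum to the
     constant 24 because [c0 + c1 <= 1]. *)
  have l0 : (X0%:R * K ^+ 2 <= 24 * B%:R * c0)%R.
    rewrite -(ler_pM2r N_gt0).
    have -> : (X0%:R * K ^+ 2 * N%:R = X0%:R * (c1 * N%:R) * (K * c0))%R by rewrite /K; ring.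
    have -> : (24 * B%:R * c0 * N%:R = (tau + tau) * (K * c0))%R.
      by rewrite [RHS]mulrA [(_ * K)%R]mulrDl tauK; ring.
    apply: ler_wpM2r; first by rewrite mulr_ge0 ?ltW.
    exact: le_trans (ler_wpM2l (ler0n R X0) hx) leX0.
  have l1 : (X1%:R * K ^+ 2 <= 24 * B%:R * c1)%R.
    rewrite -(ler_pM2r N_gt0).
    have -> : (X1%:R * K ^+ 2 * N%:R = X1%:R * (c0 * N%:R) * (K * c1))%R by rewrite /K; ring.
    have -> : (24 * B%:R * c1 * N%:R = (tau + tau) * (K * c1))%R.
      by rewrite [RHS]mulrA [(_ * K)%R]mulrDl tauK; ring.
    apply: ler_wpM2r; first by rewrite mulr_ge0 ?ltW.
    exact: le_trans (ler_wpM2l (ler0n R X1) hy) leX1.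
  rewrite mulrAC ler_pdivlMr // EX natrD mulrDl.
  have : (B%:R * (c0 + c1) <= B%:R * 1 :> R)%R by rewrite ler_wpM2l.
  lra.
have B_le : (B%:R <= 1 / K ^+ 2 * B%:R)%R.
  by rewrite ler_peMl // ler_pdivlMr // mul1r expr_le1 // ltW.
(* 49 = 24 + 24 + 1: for a colour [c] other than [i], an error at [g] entails an error of colour [i]
   at [g] or at [swap g], or else that [swap g] is overfull. *)
have split49 : (49 / K ^+ 2 * B%:R = 24 / K ^+ 2 * B%:R + 24 / K ^+ 2 * B%:R + 1 / K ^+ 2 * B%:R)%R.
  by rewrite -!mulrDl; congr (_ / _ * _)%R; ring.
have E_ge0 := ler0n R E.
rewrite split49; have [->|ci] := eqVneq c i.
  have : (X0%:R <= E%:R :> R)%R by rewrite EX ler_nat leq_addr.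
  rewrite -/X0; lra.
pose swap (g : col) : col := [ffun t => tperm i c (g t)].
have swap_inj : injective swap.
  move=> g h /ffunP e; apply/ffunP => t; move: (e t); rewrite !ffunE.
  exact: perm_inj.
have : \sum_(g : col) ((g j == c) && ~~ f c g) <= E + E + B.
  have -> : E + E + B = E + \sum_g (f i (swap g) != (swap g j == i)) + \sum_g overfull f (swap g).
    by rewrite {2}/E /B; congr (_ + _ + _); exact: reindex_inj.
  rewrite -!big_split.
  apply: leq_sum => g _ /=.
  case: eqP => //= gj; case fg: (f c g) => //=.
  case: (f i g =P (g j == i)) => //= e1; case: (f i (swap g) =P (swap g j == i)) => //= e2.
  by rewrite (overfull_swap ci gj) ?fg.
rewrite -(ler_nat R) !natrD; lra.
Qed.
End RobustDictator.

(** * Biased measures *)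

Section BiasedMeasure.
Variables (R : realFieldType) (T : finType).
Implicit Types (p c : R) (t : T) (s : seq T) (F G : {set T} -> R).
Implicit Types (B D E : {set T}) (U : {set {set T}}).
Local Open Scope ring_scope.

Definition resample p t F B : R := p * F (t |: B) + (1 - p) * F (B :\ t).

(** Expectation when each point of [s] is included independently with probability [p] and the other
    points are as in [B]. The recursion lets inequalities be proved one point at a time. *)
Definition expect p s F : {set T} -> R := foldr (resample p) F s.

Lemma ler_expect p s F G : 0 <= p <= 1 -> (forall B, F B <= G B) ->
  forall B, expect p s F B <= expect p s G B.
Proof.
move=> /andP[p0 p1] le; elim: s => //= t s IH B.
by rewrite /resample lerD // ler_wpM2l // subr_ge0.
Qed.

Lemma expect_affine p s c d F B :
  expect p s (fun B => c + d * F B) B = c + d * expect p s F B.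
Proof. by elim: s B => //= t s IH B; rewrite /resample !IH; ring. Qed.

Lemma expect_local p s F B B' :
  (forall u, u \notin s -> (u \in B) = (u \in B')) -> expect p s F B = expect p s F B'.
Proof.
elim: s B B' => [|t s IH] B B' e /=.
  by congr F; apply/setP => u; rewrite e.
rewrite /resample; congr (_ * _ + _ * _); apply: IH => u us; rewrite !inE;
  by case: eqP => //= ut; rewrite e // inE negb_or us andbT; apply/eqP.
Qed.

Lemma expect_card_sqr p c s B : uniq s -> all [pred t | t \notin B] s ->
  expect p s (fun B => (#|B|%:R - c) ^+ 2) B
    = (#|B|%:R + (size s)%:R * p - c) ^+ 2 + (size s)%:R * p * (1 - p).
Proof.
elim: s B => [|t s IH] B /=; first by rewrite !mul0r !addr0.
move=> /andP[ts us] /andP[tB sB]; rewrite /resample !IH //; last first.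
- apply/allP => u /[dup] /(allP sB) /= uB us'; rewrite !inE negb_or uB andbT.
  by apply: contraNneq ts => <-.
- by apply/allP => u /(allP sB) /= uB; rewrite !inE negb_and uB orbT.
rewrite cardsU1 tB add1n (_ : B :\ t = B); last first.
  by apply/setDidPl; rewrite disjoint_sym disjoints1.
by rewrite -!natr1; ring.
Qed.

Definition weight p B : R := p ^+ #|B| * (1 - p) ^+ #|~: B|.

Definition biased p U : R := \sum_(B in U) weight p B.

Lemma sum_weight p : \sum_B weight p B = 1.
Proof.
transitivity (\prod_(t : T) (p + (1 - p))); last first.
  by rewrite big1 // => t _; rewrite addrC subrK.
rewrite bigA_distr; apply: eq_bigr => B _; rewrite (bigID (mem B)) /=.
rewrite /weight -!prodr_const; congr (_ * _).
  by apply: eq_bigr => t ->.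
by apply: eq_big => t; rewrite ?inE // => /negPf ->.
Qed.

Lemma sum_set_split t F :
  \sum_B F B = \sum_(B : {set T} | t \notin B) (F B + F (t |: B)).
Proof.
rewrite (bigID (fun B : {set T} => t \notin B)) /= big_split /=; congr (_ + _).
rewrite (reindex_onto (fun B : {set T} => t |: B) (fun B => B :\ t)) /=; last first.
  by move=> B; rewrite negbK => /setD1K.
apply: eq_bigl => B; rewrite !inE eqxx /=; apply/eqP/idP => [<-|tB].
  by rewrite !inE eqxx.
by rewrite setU1K.
Qed.

(** The biased measure is stationary under resampling one coordinate, which is checked on each pair
    [B], [t |: B]. *)
Lemma sum_weight_resample p t F :
  \sum_B weight p B * resample p t F B = \sum_B weight p B * F B.
Proof.
rewrite !(sum_set_split t); apply: eq_bigr => B tB.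
have wB : weight p B = p ^+ #|B| * (1 - p) ^+ #|~: (t |: B)| * (1 - p).
  rewrite /weight -mulrA -exprSr; congr (_ * _ ^+ _).
  by rewrite (cardsD1 t (~: B)) inE tB add1n setCU setIC -setDE.
have wtB : weight p (t |: B) = p ^+ #|B| * (1 - p) ^+ #|~: (t |: B)| * p.
  by rewrite /weight cardsU1 tB add1n exprS; ring.
rewrite wB wtB /resample setUA setUid setU1K //.
rewrite (_ : B :\ t = B); last by apply/setDidPl; rewrite disjoint_sym disjoints1.
ring.
Qed.

(** By stationarity, averaging [expect p (enum T) F] gives the average of [F]; but once every point
    is resampled the starting set is forgotten, so the averaged function is constant. *)
Lemma expect_sum p F B : expect p (enum T) F B = \sum_B weight p B * F B.
Proof.
have inv s : \sum_B weight p B * expect p s F B = \sum_B weight p B * F B.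
  by elim: s => //= t s IH; rewrite sum_weight_resample.
rewrite -(inv (enum T)) (eq_bigr (fun D => weight p D * expect p (enum T) F B)); last first.
  move=> D _; congr (_ * _); apply: expect_local => u.
  by rewrite mem_enum.
by rewrite -big_distrl /= sum_weight mul1r.
Qed.

Lemma biased_expect p U B : biased p U = expect p (enum T) (fun B => (B \in U)%:R) B.
Proof.
rewrite expect_sum /biased big_mkcond; apply: eq_bigr => D _.
by case: (D \in U); rewrite ?mulr1 ?mulr0.
Qed.

Definition upward U := forall B B', B \in U -> B \subset B' -> B' \in U.

(** Double counting of the pairs [B \subset D] of sizes [k] and [m] with [B] in [U]; then [D] is in
    [U] too. *)
Lemma local_LYM U k m : upward U -> (k <= m <= #|T|)%N ->
  (#|[set B in U | #|B| == k]| * 'C(#|T|, m) <= #|[set B in U | #|B| == m]| * 'C(#|T|, k))%N.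
Proof.
move=> upU /andP[km mT].
have above B : #|B| = k -> #|[set D : {set T} | (B \subset D) && (#|D| == m)]|
    = 'C(#|T| - k, m - k).
  move=> Bk; rewrite -bin_sub ?leq_sub2r // subnBA // subnK; last exact: leq_trans km mT.
  rewrite -(_ : #|~: B| = #|T| - k)%N; last by rewrite -Bk -(cardsC B) addKn.
  rewrite -cards_draws -(card_imset _ (@setC_inj T)).
  congr #|pred_of_set _|; apply/setP => D; rewrite !inE.
  apply/imsetP/andP => [[E]|[DB /eqP Dm]].
    rewrite inE => /andP[BE /eqP Em] ->; rewrite setCS BE; split=> //.
    by apply/eqP; rewrite -Em -(cardsC E) addKn.
  exists (~: D); last by rewrite setCK.
  rewrite inE -(setCK B) setCS DB /=; apply/eqP.
  have := cardsC D; lia.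
have below D : #|D| = m -> #|[set B : {set T} | (B \subset D) && (#|B| == k)]| = 'C(m, k).
  by move=> <-; exact: cards_draws.
have dc : (#|[set B in U | #|B| == k]| * 'C(#|T| - k, m - k)
    <= #|[set B in U | #|B| == m]| * 'C(m, k))%N.
  rewrite -!sum_nat_const.
  rewrite (eq_bigr (fun B : {set T} =>
    \sum_(D : {set T} | (B \subset D) && (#|D| == m)) 1)%N); last first.
    by move=> B; rewrite inE => /andP[_ /eqP Bk]; rewrite -(above B Bk) -sum1dep_card.
  rewrite [leqRHS](eq_bigr (fun D : {set T} =>
    \sum_(B : {set T} | (B \subset D) && (#|B| == k)) 1)%N); last first.
    by move=> D; rewrite inE => /andP[_ /eqP Dm]; rewrite -(below D Dm) -sum1dep_card.
  rewrite (exchange_big_dep (fun D => D \in [set B in U | #|B| == m])) /=; last first.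
    by move=> B D; rewrite !inE => /andP[BU _] /andP[BD ->]; rewrite (upU _ _ BU BD).
  apply: leq_sum => D _; rewrite !sum1dep_card; apply: subset_leq_card; apply/fintype.subsetP => B.
  by rewrite !inE => /andP[/andP[_ ->] /andP[-> _]].
have eC : ('C(#|T|, k) * 'C(#|T| - k, m - k) = 'C(#|T|, m) * 'C(m, k))%N.
  have kT := leq_trans km mT.
  have f1 := bin_fact kT; have f2 := bin_fact mT; have f3 := bin_fact km.
  have f4 := bin_fact (leq_sub2r k mT).
  have e : (#|T| - k - (m - k) = #|T| - m)%N by lia.
  rewrite e in f4.
  have g1 := fact_gt0 k; have g2 := fact_gt0 (#|T| - m); have g3 := fact_gt0 (m - k).
  apply/eqP; rewrite -(eqn_pmul2r g1) -(eqn_pmul2r g2) -(eqn_pmul2r g3); apply/eqP.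
  transitivity (#|T|`!)%N.
    by rewrite -f1 -f4; ring.
  by rewrite -f2 -f3; ring.
have C_gt0 : (0 < 'C(m, k))%N by rewrite bin_gt0.
rewrite -(leq_pmul2r C_gt0).
have -> : (#|[set B in U | #|B| == k]| * 'C(#|T|, m) * 'C(m, k)
    = #|[set B in U | #|B| == k]| * 'C(#|T| - k, m - k) * 'C(#|T|, k))%N.
  by rewrite -mulnA -eC; lia.
rewrite (_ : _ * 'C(m, k) = #|[set B in U | #|B| == m]| * 'C(m, k) * 'C(#|T|, k))%N; last by lia.
by rewrite leq_mul2r dc orbT.
Qed.

(** [weight p] is constant on each level, so bounds on the level averages of [F] integrate. *)
Lemma biased_levels p F (phi : nat -> R) :
  (forall m, (m <= #|T|)%N -> phi m * 'C(#|T|, m)%:R <= \sum_(B : {set T} | #|B| == m) F B) ->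
  0 <= p <= 1 -> \sum_B weight p B * phi #|B| <= \sum_B weight p B * F B.
Proof.
move=> hF /andP[p0 p1].
have cardB B : (#|B| < #|T|.+1)%N by rewrite ltnS max_card.
rewrite (partition_big (fun B => Ordinal (cardB B)) xpredT) //=.
rewrite [leRHS](partition_big (fun B => Ordinal (cardB B)) xpredT) //=.
apply: ler_sum => m _.
pose w : R := p ^+ m * (1 - p) ^+ (#|T| - m).
have ew B : Ordinal (cardB B) == m -> weight p B = w.
  rewrite /weight /w => /eqP /(congr1 val) /= <-; congr (_ * _ ^+ _).
  by rewrite -(cardsC B) addKn.
rewrite (eq_bigr (fun=> w * phi m)); last first.
  by move=> B Bm; rewrite ew //; move/eqP: Bm => /(congr1 val) /= ->.
rewrite [leRHS](eq_bigr (fun B => w * F B)); last by move=> B Bm; rewrite ew.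
rewrite -!big_distrr /= ler_wpM2l ?mulr_ge0 ?exprn_ge0 ?subr_ge0 //.
have e B : (Ordinal (cardB B) == m) = (#|B| == m) by [].
have mT : (m <= #|T|)%N by rewrite -ltnS.
rewrite (eq_bigl _ _ e) [leRHS](eq_bigl _ _ e); apply: le_trans (hF m mT).
by rewrite sumr_const mulr_natr -card_draws cardsE.
Qed.

Lemma biased_ge_tail p U k : upward U -> 0 <= p <= 1 -> (k <= #|T|)%N ->
  #|[set B in U | #|B| == k]|%:R / 'C(#|T|, k)%:R * \sum_(B : {set T} | (k <= #|B|)%N) weight p B
    <= biased p U.
Proof.
move=> upU p01 kT; set d := _ / _.
have C_gt0 m : (m <= #|T|)%N -> 0 < 'C(#|T|, m)%:R :> R by move=> ?; rewrite ltr0n bin_gt0.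
rewrite /biased (big_mkcond (fun B => B \in U)) big_distrr /= big_mkcond /=.
rewrite [leRHS](eq_bigr (fun B => weight p B * (B \in U)%:R)); last first.
  by move=> B _; case: (B \in U); rewrite ?mulr1 ?mulr0.
apply: le_trans (biased_levels (phi := fun m => if (k <= m)%N then d else 0) _ p01).
  by apply: ler_sum => B _; case: (k <= _)%N; rewrite ?mulr0 // mulrC.
move=> m mT; have [km|_] := leqP k m; last by rewrite mul0r sumr_ge0 // => B _; rewrite ler0n.
have -> : \sum_(B : {set T} | #|B| == m) (B \in U)%:R = #|[set B in U | #|B| == m]|%:R :> R.
  rewrite -natr_sum -sum1dep_card; congr _%:R.
  by rewrite [RHS]big_mkcondl; apply: eq_bigr => B _; case: (B \in U).
rewrite /d mulrAC ler_pdivrMr ?C_gt0 // -!natrM ler_nat.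
by apply: local_LYM => //; rewrite km mT.
Qed.

(** Chebyshev's inequality in pointwise form: one minus the squared deviation of [#|B|] from its
    mean, divided by [(#|T|%:R * p - k%:R) ^+ 2], is at most the indicator of [k <= #|B|]. Taking
    expectations bounds the tail weight from below. *)
Lemma biased_ge p U k : upward U -> 0 <= p <= 1 -> (k <= #|T|)%N -> k%:R < #|T|%:R * p ->
  #|[set B in U | #|B| == k]|%:R / 'C(#|T|, k)%:R
    * (1 - #|T|%:R * p * (1 - p) / (#|T|%:R * p - k%:R) ^+ 2) <= biased p U.
Proof.
move=> upU p01 kT k_lt; apply: le_trans (biased_ge_tail upU p01 kT).
have D_gt0 : 0 < (#|T|%:R * p - k%:R) ^+ 2 by rewrite exprn_gt0 // subr_gt0.
rewrite ler_wpM2l ?divr_ge0 ?ler0n //.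
have var : expect p (enum T) (fun B => (#|B|%:R - #|T|%:R * p) ^+ 2) set0
    = #|T|%:R * p * (1 - p).
  rewrite expect_card_sqr ?enum_uniq //; last by apply/allP => t _ /=; rewrite inE.
  by rewrite -cardE cards0 add0r subrr expr0n add0r.
have -> : \sum_(B : {set T} | (k <= #|B|)%N) weight p B
    = expect p (enum T) (fun B => (k <= #|B|)%N%:R) set0.
  rewrite expect_sum big_mkcond; apply: eq_bigr => B _.
  by case: (k <= _)%N; rewrite ?mulr1 ?mulr0.
set V := (_ ^+ 2) in D_gt0 *.
have -> : 1 - #|T|%:R * p * (1 - p) / V
    = 1 + - V^-1 * expect p (enum T) (fun B => (#|B|%:R - #|T|%:R * p) ^+ 2) set0.
  by rewrite var mulNr mulrC.
rewrite -expect_affine; apply: ler_expect => // B.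
have sq_ge0 := sqr_ge0 (#|B|%:R - #|T|%:R * p).
case: leqP => [_|Bk].
  by rewrite mulNr gerDl oppr_le0 mulr_ge0 // invr_ge0 ltW.
rewrite mulNr subr_le0 -[leLHS](mulVf (lt0r_neq0 D_gt0)) ler_wpM2l ?invr_ge0 ?(ltW D_gt0) //.
have Bk' : #|B|%:R < k%:R :> R by rewrite ltr_nat.
rewrite -sqrrN opprB; apply: lerXn2r; rewrite ?nnegrE ?subr_ge0; lra.
Qed.

Definition upclosure (A : {set {set T}}) : {set {set T}} :=
  [set B : {set T} | [exists D in A, D \subset B]].

Lemma upclosure_upward (A : {set {set T}}) : upward (upclosure A).
Proof.
move=> B B'; rewrite !inE => /exists_inP[D DA DB] BB'.
by apply/exists_inP; exists D => //; exact: fintype.subset_trans BB'.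
Qed.

Lemma sub_upclosure (A : {set {set T}}) : A \subset upclosure A.
Proof. by apply/fintype.subsetP => B BA; rewrite inE; apply/exists_inP; exists B. Qed.

(** Given [[set t | g t != c] = B], a point of [B] has [#|C|.-1] possible colours and any other
    point only [c]. *)
Lemma sum_colouring (C : finType) (c : C) (F : {set T} -> nat) :
  (\sum_(g : {ffun T -> C}) F [set t | g t != c] = \sum_(B : {set T}) #|C|.-1 ^ #|B| * F B)%N.
Proof.
rewrite (partition_big (fun g : {ffun T -> C} => [set t | g t != c]) xpredT) //=.
apply: eq_bigr => B _; rewrite (eq_bigr (fun=> F B)); last by move=> g /eqP ->.
rewrite sum_nat_const; congr (_ * _)%N.
rewrite (eq_card (B := family (fun t => if t \in B then predC1 c else pred1 c))); last first.
  move=> g; change (([set t | g t != c] == B)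
    = (g \in family (fun t => if t \in B then predC1 c else pred1 c))).
  apply/eqP/familyP => [<- t|e].
    by rewrite [t \in finset _]inE; case: (g t =P c) => [->|/eqP gt] /=; rewrite inE.
  apply/setP => t; move: (e t); rewrite [t \in finset _]inE.
  by case: (t \in B); rewrite !inE // => ->.
rewrite card_family foldrE big_map big_enum /= (bigID (mem B)) /=.
rewrite (eq_bigr (fun=> #|C|.-1)); last by move=> t ->; exact: cardC1.
rewrite [X in (_ * X)%N]big1 ?muln1 ?prod_nat_const // => t /negPf ->.
exact: card1.
Qed.

Lemma biased_colouring (C : finType) (c : C) U :
  (\sum_(g : {ffun T -> C}) ([set t | g t != c] \in U))%:R
    = #|{ffun T -> C}|%:R * biased (#|C|.-1%:R / #|C|%:R) U.
Proof.
have C_gt0 : (0 < #|C|)%N by apply/card_gt0P; exists c.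
rewrite (sum_colouring c (fun B => B \in U)) natr_sum /biased big_distrr /=.
rewrite [RHS]big_mkcond; apply: eq_bigr => B _ /=.
case: (B \in U); rewrite ?muln0 // muln1 natrX card_ffun natrX /weight.
have -> : 1 - #|C|.-1%:R / #|C|%:R = #|C|%:R^-1 :> R.
  rewrite -{1}(divff (x := #|C|%:R)) ?pnatr_eq0 -?lt0n //.
  by rewrite -mulrBl -natrB ?leq_pred // -{1}(prednK C_gt0) subSnn mul1r.
rewrite -(cardsC B) exprD mulrACA -!exprMn mulrCA divff ?pnatr_eq0 -?lt0n //.
by rewrite mulr1 expr1n mulr1.
Qed.

End BiasedMeasure.

(** * Cross-intersecting families *)

Section CrossIntersecting.
Variables (R : realFieldType) (n r k : nat) (A : 'I_r -> {set {set 'I_n}}).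
Hypothesis hcross : cross_intersecting A.
Hypothesis r_gt2 : (2 < r)%N.
Local Notation col := {ffun 'I_n -> 'I_r}.
Local Open Scope ring_scope.

Definition misses (i : 'I_r) : pred col :=
  fun g => [set t | g t != i] \notin upclosure (A i).

Lemma misses_mono c (g h : col) :
  (forall t, g t == c -> h t == c) -> misses c g -> misses c h.
Proof.
move=> gh; rewrite /misses; apply: contra => /upclosure_upward; apply.
by apply/fintype.subsetP => t; rewrite !inE; apply: contra; exact: gh.
Qed.

Lemma misses_cover (g : col) : exists c, misses c g.
Proof.
apply/existsP; rewrite -[X in is_true X]negbK negb_exists; apply/negP => /forallP all_in.
(* The default [set0] is never taken: [all_in] provides a member of each [A i]. *)
pose B i := odflt set0 [pick D in A i | D \subset [set t | g t != i]].
have hB i : B i \in A i /\ B i \subset [set t | g t != i].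
  rewrite /B; case: pickP => [D /andP[] //|no].
  move: (all_in i); rewrite /misses negbK inE => /exists_inP[D DA DB].
  by have := no D; rewrite /= DA DB.
have /set0Pn[t /bigcapP tB] := hcross (fun i => (hB i).1).
have := fintype.subsetP (hB (g t)).2 t (tB (g t) isT).
by rewrite inE eqxx.
Qed.

Local Notation q := (r.-1%:R / r%:R : R).
Local Notation N := (#|{: col}|%:R : R).

Lemma sum_not_misses i :
  (\sum_(g : col) ~~ misses i g)%:R = N * biased q (upclosure (A i)).
Proof.
have := biased_colouring R i (upclosure (A i)); rewrite card_ord => <-.
by congr _%:R; apply: eq_bigr => g _; rewrite /misses negbK.
Qed.

Lemma sum_misses i :
  (\sum_(g : col) misses i g)%:R = N * (1 - biased q (upclosure (A i))).
Proof.
rewrite mulrBr mulr1 -sum_not_misses; apply/eqP; rewrite eq_sym subr_eq; apply/eqP.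
rewrite -natrD -big_split -sum1_card /=; congr _%:R.
by apply: eq_bigr => g _; case: (misses i g).
Qed.

Lemma col_gt0 : 0 < N.
Proof.
rewrite ltr0n; apply/card_gt0P; exists [ffun=> Ordinal (ltnW (ltnW r_gt2))].
by [].
Qed.

Lemma sum_overfull_le :
  (\sum_(g : col) overfull misses g)%:R
    <= N * (r%:R - 1 - \sum_i biased q (upclosure (A i))).
Proof.
have -> : N * (r%:R - 1 - \sum_i biased q (upclosure (A i)))
    = (\sum_(g : col) \sum_i misses i g)%:R - N.
  rewrite exchange_big natr_sum (eq_bigr _ (fun i _ => sum_misses i)) -big_distrr /=.
  by rewrite sumrB sumr_const card_ord; ring.
rewrite lerBrDr -natrD ler_nat -sum1_card -big_split; apply: leq_sum => g _ /=.
by rewrite addnC cover_sum //; exact: misses_cover.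
Qed.

Lemma sum_biased_le : \sum_i biased q (upclosure (A i)) <= r%:R - 1.
Proof.
rewrite -subr_ge0 -(pmulr_rge0 _ col_gt0).
by apply: le_trans sum_overfull_le; exact: ler0n.
Qed.

Lemma exists_often_missed : exists i, r%:R^-1 * N <= (\sum_(g : col) misses i g)%:R.
Proof.
apply/existsP; rewrite -[X in is_true X]negbK negb_exists; apply/negP => /forallP few.
have r_gt0 : 0 < r%:R :> R by rewrite ltr0n; lia.
have : \sum_(i < r) (\sum_(g : col) misses i g)%:R < \sum_(i < r) r%:R^-1 * N.
  apply: ltr_sum => [|i _]; last by rewrite ltNge few.
  by apply/hasP; exists (Ordinal (ltnW (ltnW r_gt2))); rewrite ?mem_index_enum.
rewrite sumr_const card_ord -[_ *+ r]mulr_natl mulrA divff ?gt_eqF // mul1r -natr_sum exchange_big.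
apply/negP; rewrite -leNgt ler_nat -sum1_card; apply: leq_sum => g _.
by apply: leq_trans (cover_sum misses_cover g); rewrite leq_addr.
Qed.

(** Whether a member of [B] fits into [[set t | g t != c]] is decided by the colours off [j], hence
    is independent of the event [g j = c], which has probability [1 / r]. *)
Lemma sum_avoiding_le (B : {set {set 'I_n}}) (j : 'I_n) (c : 'I_r) :
  (forall D, D \in B -> j \notin D) ->
  (\sum_(g : col) ([set t | g t != c] \in upclosure B)
    <= r * \sum_(g : col) ((g j == c) && ([set t | g t != c] \in upclosure B)))%N.
Proof.
move=> jB; pose Y (g : col) := [set t | g t != c] \in upclosure B.
have N_gt0 : (0 < #|{: col}|)%N by rewrite -(ltr0n R) col_gt0.
rewrite -(leq_pmul2l N_gt0) mulnCA -(sum_mix [set j] (fun g => (g j == c) && Y g)).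
rewrite -{1}(sum_colour_at j c) card_ord -mulnA leq_mul2l; apply/orP; right.
rewrite big_distrl; apply: leq_sum => h _; rewrite big_distrr; apply: leq_sum => g _ /=.
rewrite ffunE inE eqxx; case: eqP => //= hj; rewrite mul1n.
case Yg: (_ \in _) => //; rewrite /Y.
move: Yg; rewrite !inE => /exists_inP[D DB Dg].
suff -> : [exists D0 in B, D0 \subset [set t | mix [set j] h g t != c]] by [].
apply/exists_inP; exists D => //; apply/fintype.subsetP => t tD.
have := fintype.subsetP Dg t tD; rewrite !inE ffunE inE.
by case: (t =P j) => // tj; have := jB D DB; rewrite -tj tD.
Qed.

(** [robust_dictator] applied to [misses] yields [j]. The members of [A c] outside the star avoid
    [j], so [sum_avoiding_le] reduces the measure of their up-closure to the rare colourings with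
    [g j = c] at which [c] is not missed. *)
Theorem cross_intersecting_stability (c0 : R) :
    (0 < n)%N -> (k <= n)%N -> (forall i, A i \subset ksubsets n k) ->
    0 < c0 -> (forall i, c0 <= biased q (upclosure (A i))) -> k%:R < n%:R * q ->
  exists j : 'I_n, forall i, #|A i :\: star n k j|%:R / 'C(n, k)%:R
      * (1 - n%:R * q * (1 - q) / (n%:R * q - k%:R) ^+ 2)
    <= 49 * r%:R ^+ 3 / c0 ^+ 2 * (r%:R - 1 - \sum_i biased q (upclosure (A i))).
Proof.
move=> n_gt0 kn hA c0_gt0 hc0 kq.
have r_gt0 : 0 < r%:R :> R by rewrite ltr0n; lia.
have [i hi] := exists_often_missed.
have [||||j hj] := @robust_dictator R _ _ misses misses_mono misses_cover i c0 r%:R^-1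
    _ (Ordinal n_gt0) _ _ hi.
- by rewrite card_ord.
- by [].
- by rewrite invr_gt0.
- by rewrite sum_not_misses mulrC ler_wpM2l // ltW // col_gt0.
exists j => c; set B := A c :\: star n k j.
have jB D : D \in B -> j \notin D.
  rewrite !inE => /andP[+ DA]; have := fintype.subsetP (hA c) D DA; rewrite inE => -> /=.
  by apply: contra => jD; apply/exists_inP; exists j.
have Bk D : D \in B -> #|D| = k.
  by move=> /setDP[/(fintype.subsetP (hA c))]; rewrite inE => /eqP.
have q01 : 0 <= q <= 1.
  by rewrite divr_ge0 ?ler0n //= ler_pdivrMr // mul1r ler_nat leq_pred.
have := @biased_ge R _ q (upclosure B) k (@upclosure_upward _ B) q01.
rewrite card_ord => /(_ kn kq).
have -> : [set D in upclosure B | #|D| == k] = B.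
  apply/setP => D; rewrite inE; apply/andP/idP => [[+ /eqP Dk]|DB].
    rewrite inE => /exists_inP[E EB ED]; suff <- : E = D by [].
    by apply/eqP; rewrite eqEcard ED Dk (Bk E EB) /=.
  by rewrite (fintype.subsetP (sub_upclosure B)) ?Bk.
move=> /le_trans; apply; rewrite -(ler_pM2l col_gt0).
have := biased_colouring R c (upclosure B); rewrite card_ord => <-.
(* One factor [r] comes from [sum_avoiding_le], two more from [c1 = 1 / r], supplied by
   [exists_often_missed]. *)
apply: (@le_trans _ _ (r%:R * (49 / (c0 * r%:R^-1) ^+ 2
   * (\sum_(g : col) overfull misses g)%:R))).
  apply: le_trans (ler_wpM2l (ltW r_gt0) (hj c)).
  rewrite -natrM ler_nat; apply: leq_trans (sum_avoiding_le c jB) _.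
  rewrite leq_mul2l; apply/orP; right; apply: leq_sum => g _.
  case: (_ == _) => //=; rewrite /misses negbK.
  case Bg: (_ \in _) => //; move: Bg; rewrite !inE => /exists_inP[D /setDP[DA _] Dg].
  by suff -> : [exists D in A c, D \subset [set t | g t != c]] by []; apply/exists_inP; exists D.
have := sum_overfull_le; set S := (\sum_g _)%:R; set W := _ - _ - _ => SW.
have -> : r%:R * (49 / (c0 * r%:R^-1) ^+ 2 * S) = 49 * r%:R ^+ 3 / c0 ^+ 2 * S.
  by field; rewrite !gt_eqF.
rewrite [leRHS]mulrCA ler_wpM2l //.
by rewrite divr_ge0 ?mulr_ge0 ?exprn_ge0 ?ltW.
Qed.

End CrossIntersecting.

(** * Distance to the star *)

Section StarDistance.
Variables (R : realFieldType) (n r k : nat) (A : 'I_r -> {set {set 'I_n}}) (j : 'I_n).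
Hypothesis k_gt0 : (0 < k)%N.
Hypothesis kn : (k <= n)%N.
Local Open Scope ring_scope.

Lemma card_star_le : (#|star n k j| <= 'C(n.-1, k.-1))%N.
Proof.
have <- : #|[set~ j]| = n.-1 by rewrite cardsC1 card_ord.
have star_j B : B \in star n k j -> j \in B /\ #|B| = k.
  by rewrite !inE => /andP[/eqP Bk /exists_inP[x xB /eqP/val_inj <-]].
rewrite -cards_draws -(card_in_imset (f := fun B => B :\ j) (D := star n k j)).
  apply/subset_leq_card/fintype.subsetP => _ /imsetP[B /star_j[jB Bk] ->].
  by rewrite inE subsetDr -Bk (cardsD1 j B) jB /=.
move=> B D /star_j[jB _] /star_j[jD _] e.
by rewrite -(setD1K jB) e setD1K.
Qed.

Lemma bin_pred : 'C(n.-1, k.-1)%:R = k%:R / n%:R * 'C(n, k)%:R :> R.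
Proof.
have n_neq0 : n%:R != 0 :> R by rewrite pnatr_eq0 -lt0n (leq_trans k_gt0).
have := mul_bin_diag n k.-1; rewrite prednK // => e.
by apply: (mulfI n_neq0); rewrite -natrM e natrM; field.
Qed.

(** Bernoulli's inequality. *)
Lemma expr_1sub_ge (u : R) m : 0 <= u <= 1 -> 1 - m%:R * u <= (1 - u) ^+ m.
Proof.
move=> /andP[u0 u1]; elim: m => [|m IH]; first by rewrite mul0r subr0 expr0.
rewrite exprS -natr1.
have : (1 - u) * (1 - m%:R * u) <= (1 - u) * (1 - u) ^+ m by rewrite ler_wpM2l // subr_ge0.
have : 0 <= m%:R * u * u by rewrite !mulr_ge0 ?ler0n.
lra.
Qed.

(** Every density is at most [x + e], so the product keeps each [D i] from falling far below [x]. A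
    family of nearly the size of the star that hardly leaves it must nearly fill it. *)
Lemma symdiff_star_le (a e d : R) :
    0 < a -> 0 <= e -> 0 <= d -> a <= k%:R / n%:R ->
    (1 - d) * (k%:R / n%:R) ^+ r <= \prod_(i < r) (#|A i|%:R / 'C(n, k)%:R) ->
    (forall i, #|A i :\: star n k j|%:R / 'C(n, k)%:R <= e) ->
  forall i, #|symdiff (A i) (star n k j)|%:R / 'C(n.-1, k.-1)%:R
    <= (2 * e + d + r%:R * e / a) / a.
Proof.
move=> a_gt0 e_ge0 d_ge0; set x := _ / _ => ax hprod he i.
have C_gt0 : 0 < 'C(n, k)%:R :> R by rewrite ltr0n bin_gt0.
have eC : 'C(n.-1, k.-1)%:R = x * 'C(n, k)%:R :> R by exact: bin_pred.
have x_gt0 : 0 < x by exact: lt_le_trans ax.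
pose D i : R := #|A i|%:R / 'C(n, k)%:R.
have D_ge0 l : 0 <= D l by rewrite divr_ge0 ?ler0n.
have cardA l : #|A l| = (#|A l :&: star n k j| + #|A l :\: star n k j|)%N by rewrite cardsID.
have D_le l : D l <= x + e.
  rewrite -lerBlDr; apply: le_trans (lerB (lexx (D l)) (he l)) _.
  rewrite /D -mulrBl ler_pdivrMr // -eC lerBlDr -natrD ler_nat cardA leq_add2r.
  apply: leq_trans card_star_le; exact: subset_leq_card (subsetIr _ _).
have x1 : x <= 1 by rewrite ler_pdivrMr ?ltr0n ?(leq_trans k_gt0) // mul1r ler_nat.
have r_gt0 : (0 < r)%N by exact: leq_ltn_trans (ltn_ord i).
have lowD : x - D i <= d + r%:R * e / a.
  have xe_gt0 : 0 < x + e by rewrite ltr_wpDr.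
  have : (1 - d) * x ^+ r <= D i * (x + e) ^+ r.-1.
    apply: le_trans hprod _; rewrite (bigD1 i) //= -/(D i) ler_wpM2l //.
    apply: (@le_trans _ _ (\prod_(l < r | l != i) (x + e))).
      by apply: ler_prod => l _; rewrite D_ge0 D_le.
    by rewrite prodr_const (_ : #|_| = r.-1) // (cardC1 i) card_ord.
  pose u := e / (x + e).
  have u01 : 0 <= u <= 1.
    by rewrite /u divr_ge0 ?(ltW xe_gt0) //= ler_pdivrMr // mul1r lerDr ltW.
  have ex : x = (1 - u) * (x + e) by rewrite /u; field; rewrite gt_eqF.
  have -> : (1 - d) * x ^+ r = ((1 - d) * (1 - u) ^+ r.-1 * x) * (x + e) ^+ r.-1.
    rewrite -[in LHS](prednK r_gt0) exprSr.
    have -> : x ^+ r.-1 = (1 - u) ^+ r.-1 * (x + e) ^+ r.-1 by rewrite -exprMn -ex.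
    ring.
  rewrite ler_pM2r ?exprn_gt0 //.
  have := expr_1sub_ge r.-1 u01; have : (1 - u) ^+ r.-1 <= 1.
    by rewrite exprn_ile1 // ?subr_ge0 ?gerBl; case/andP: u01.
  move: ((1 - u) ^+ r.-1) => w w1 wge hD.
  have ru : r.-1%:R * u <= r%:R * e / a.
    rewrite -mulrA ler_pM ?ler0n ?ler_nat ?leq_pred //; first by case/andP: u01.
    by rewrite /u ler_wpM2l // lef_pV2 ?posrE // (le_trans ax) // lerDl.
  have ge : 1 - d - r%:R * e / a <= (1 - d) * w.
    have : d * w <= d * 1 by rewrite ler_wpM2l.
    lra.
  have : (1 - d - r%:R * e / a) * x <= D i by apply: le_trans hD; rewrite ler_wpM2r // ltW.
  have : 0 <= d + r%:R * e / a by rewrite addr_ge0 // mulr_ge0 ?invr_ge0 ?mulr_ge0 ?ler0n // ltW.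
  move: (r%:R * e / a) => W W0; have : (d + W) * x <= (d + W) * 1 by rewrite ler_wpM2l.
  lra.
have sd : #|symdiff (A i) (star n k j)|%:R / 'C(n, k)%:R <= 2 * e + d + r%:R * e / a.
  (* The part of the star missing from [A i] has size at most ['C(n.-1, k.-1)] minus [#|A i|] plus
     the part of [A i] outside the star, so that outside part counts twice. *)
  have : #|symdiff (A i) (star n k j)|%:R / 'C(n, k)%:R
      <= x - D i + #|A i :\: star n k j|%:R / 'C(n, k)%:R *+ 2.
    rewrite ler_pdivrMr //.
    have -> : (x - D i + #|A i :\: star n k j|%:R / 'C(n, k)%:R *+ 2) * 'C(n, k)%:R
        = 'C(n.-1, k.-1)%:R + (#|A i :\: star n k j| + #|A i :\: star n k j|)%:R - #|A i|%:R.
      by rewrite natrD /D eC; field; rewrite gt_eqF.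
    rewrite lerBrDr -!natrD ler_nat.
    apply: leq_trans (leq_add card_star_le (leqnn _)).
    rewrite /symdiff cardA.
    have := cardsID (A i) (star n k j); rewrite finset.setIC.
    have := (leq_card_setU (A i :\: star n k j) (star n k j :\: A i)).1; lia.
  by have := he i; lra.
rewrite eC invfM mulrCA [leRHS]mulrC; apply: ler_pM => //.
- by rewrite invr_ge0 ltW.
- by rewrite divr_ge0 ?ler0n.
by rewrite lef_pV2 ?posrE.
Qed.
End StarDistance.

From mathcomp Require Import all_classical all_reals all_analysis.
Import numFieldNormedType.Exports.
Import Order.TTheory GRing.Theory Num.Theory.

Local Open Scope classical_set_scope.
Local Open Scope ring_scope.

(** * Comparison of the biased measures *)

Section BiasedPower.
Variable R : realType.

Lemma powR_convex (c t x y : R) : 1 <= c -> 0 <= t <= 1 -> 0 <= x -> 0 <= y ->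
  (t * x + (1 - t) * y) `^ c <= t * x `^ c + (1 - t) * y `^ c.
Proof.
move=> c1 /andP[t0 t1] x0 y0.
by apply: (convex_powR c1 (Itv01 t0 t1)); rewrite inE /= in_itv /= ?x0 ?y0.
Qed.

(** [x] and [y] are convex combinations of [a] and [b] with exchanged weights, and the two convexity
    inequalities add up. If [b <= a], all four numbers coincide. *)
Lemma powR_majorize (c a b x y : R) : 1 <= c -> 0 <= a -> a <= x -> a <= y ->
  x + y = a + b -> x `^ c + y `^ c <= a `^ c + b `^ c.
Proof.
move=> c1 a0 ax ay xy; have [ab|ba] := ltP a b; last first.
  have xa : x = a by lra.
  have ya : y = a by lra.
  by rewrite xa ya (_ : b = a) //; lra.
have ba0 : 0 < b - a by rewrite subr_gt0.
pose t := (x - a) / (b - a).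
have et : t * (b - a) = x - a by rewrite /t divfK // gt_eqF.
have t01 : 0 <= t <= 1.
  apply/andP; split; first by rewrite /t divr_ge0 ?subr_ge0 // ltW.
  by rewrite /t ler_pdivrMr // mul1r; lra.
have b0 : 0 <= b by lra.
have ex : x = t * b + (1 - t) * a by lra.
have ey : y = t * a + (1 - t) * b by lra.
have := powR_convex c1 t01 b0 a0; have := powR_convex c1 t01 a0 b0.
rewrite -ex -ey; lra.
Qed.

(* The points q u and v lie between q v and q u + (1 - q) v, with the same sum. *)
Lemma powR_two_point (q c u v : R) : 0 <= q <= 1 -> 1 <= c -> 0 <= v -> v <= u ->
  q `^ c * u `^ c + (1 - q `^ c) * v `^ c <= (q * u + (1 - q) * v) `^ c.
Proof.
move=> /andP[q0 q1] c1 v0 vu.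
have := @powR_majorize c (q * v) (q * u + (1 - q) * v) (q * u) v c1.
rewrite !powRM ?(le_trans v0 vu) //.
move=> /(_ _ _ _ _); rewrite mulr_ge0 // ler_wpM2l // ler_piMl // => /(_ isT isT isT).
have -> : q * u + v = q * v + (q * u + (1 - q) * v) by ring.
by move=> /(_ erefl); lra.
Qed.

Variable T : finType.
Implicit Types (F : {set T} -> R) (U : {set {set T}}) (s : seq T) (B : {set T}).

Lemma expect_mono p s F : 0 <= p <= 1 ->
  (forall B B', B \subset B' -> F B <= F B') ->
  forall B B', B \subset B' -> expect p s F B <= expect p s F B'.
Proof.
move=> /andP[p0 p1] Fm; elim: s => //= t s IH B B' BB'; rewrite /resample.
by rewrite lerD // ler_wpM2l ?subr_ge0 //; apply: IH; rewrite ?finset.setUS ?finset.setSD.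
Qed.

(** Induction on the points: [powR_two_point] applies to the expectations with [t] present and
    absent, which monotonicity of [F] puts in the right order. *)
Lemma expect_powR q c s F : 0 <= q <= 1 -> 1 <= c ->
  (forall B, 0 <= F B) -> (forall B B', B \subset B' -> F B <= F B') ->
  forall B, expect (q `^ c) s (fun B => F B `^ c) B <= (expect q s F B) `^ c.
Proof.
move=> q01 c1 F0 Fm; have /andP[q0 q1] := q01.
have qc01 : 0 <= q `^ c <= 1.
  rewrite powR_ge0 /= (_ : 1 = 1 `^ c); last by rewrite powR1.
  by rewrite ge0_ler_powR ?nnegrE // (le_trans ler01).
have expect_ge0 t : forall B, 0 <= expect q t F B.
  by elim: t => //= t r IH B; rewrite addr_ge0 // mulr_ge0 // subr_ge0.
elim: s => //= t s IH B; have /andP[qc0 qc1] := qc01.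
have le : expect q s F (B :\ t) <= expect q s F (t |: B).
  apply: expect_mono => //.
  exact: fintype.subset_trans (finset.subD1set _ _) (finset.subsetUr _ _).
apply: le_trans (powR_two_point q01 c1 (expect_ge0 s _) le).
by rewrite /resample lerD // ler_wpM2l // subr_ge0.
Qed.

Lemma biased_powR (q c : R) U : 0 <= q <= 1 -> 1 <= c -> upward U ->
  biased (q `^ c) U <= (biased q U) `^ c.
Proof.
move=> q01 c1 upU; rewrite !(biased_expect _ _ finset.set0).
(* An indicator is its own power, which makes [expect_powR] a statement about measures. *)
have e : (fun B => (B \in U)%:R `^ c : R) = (fun B => (B \in U)%:R).
  apply/funext => B; case: (B \in U); first by rewrite powR1.
  by rewrite powR0 // gt_eqF // (lt_le_trans ltr01).
rewrite -[in leLHS]e; apply: expect_powR => // B B' BB'.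
by rewrite ler_nat; case BU: (B \in U) => //; rewrite (upU _ _ BU BB').
Qed.

End BiasedPower.

(** * Upper bound for the product of the densities *)

Section ProductBound.
Variables (R : realType) (n r k : nat) (A : 'I_r -> {set {set 'I_n}}).
Hypothesis hcross : cross_intersecting A.
Hypothesis r_gt2 : (2 < r)%N.
Hypothesis kn : (k <= n)%N.
Hypothesis hA : forall i, A i \subset ksubsets n k.
Local Notation q := (r.-1%:R / r%:R : R).
Local Notation P i := (biased q (upclosure (A i))).
Local Notation D i := (#|A i|%:R / 'C(n, k)%:R : R).
Local Notation tail p := (1 - n%:R * p * (1 - p) / (n%:R * p - k%:R) ^+ 2).

Lemma density_le_biased (p : R) i : 0 <= p <= 1 -> k%:R < n%:R * p -> 0 <= tail p ->
  D i * tail p <= biased p (upclosure (A i)).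
Proof.
move=> p01 kp tp; have := @biased_ge R _ p (upclosure (A i)) k (@upclosure_upward _ (A i)) p01.
rewrite card_ord => /(_ kn kp); apply: le_trans; rewrite ler_wpM2r // ler_wpM2r ?invr_ge0 ?ler0n //.
rewrite ler_nat; apply/subset_leq_card/fintype.subsetP => B BA.
rewrite inE (fintype.subsetP (sub_upclosure (A i)) B BA) /=.
by have := fintype.subsetP (hA i) B BA; rewrite inE.
Qed.

Lemma prod_powR (I : finType) (F : I -> R) c : (forall i, 0 <= F i) ->
  \prod_i (F i `^ c) = (\prod_i F i) `^ c.
Proof.
move=> F0; suff [] : \prod_i (F i `^ c) = (\prod_i F i) `^ c /\ 0 <= \prod_i F i by [].
elim/big_rec2: _ => [|i x y _ [-> x0]]; first by rewrite powR1.
by rewrite powRM // mulr_ge0.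
Qed.

(** With [q] to the power [c] equal to [p], [biased_powR] passes from [p] to [q], where AM-GM and
    [sum_biased_le] apply. *)
Lemma prod_density_le (p : R) : 0 < p <= q -> k%:R < n%:R * p -> 0 <= tail p ->
  (r%:R - 1) * (\prod_i D i * tail p ^+ r) <= \sum_i P i * p ^+ r.
Proof.
move=> /andP[p0 pq] kp tp.
have r_gt0 : 0 < r%:R :> R by rewrite ltr0n; lia.
have r1_gt0 : 0 < r%:R - 1 :> R by rewrite subr_gt0 ltr1n; lia.
have er : r.-1%:R = r%:R - 1 :> R by rewrite -subn1 natrB //; lia.
have q0 : 0 < q by rewrite er divr_gt0.
have q1 : q < 1 by rewrite ltr_pdivrMr // mul1r er; lra.
have P0 i : 0 <= P i.
  by rewrite sumr_ge0 // => B _; rewrite mulr_ge0 ?exprn_ge0 ?subr_ge0 ?ltW.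
have lnq : ln q < 0 by rewrite ln_lt0 // q0 q1.
pose c := ln p / ln q.
have qc : q `^ c = p.
  by rewrite /powR gt_eqF // /c divfK ?lt_eqF // lnK.
have c1 : 1 <= c.
  rewrite /c ler_ndivlMr // mul1r ler_ln //.
have p01 : 0 <= p <= 1 by rewrite (ltW p0) (le_trans pq (ltW q1)).
have q01 : 0 <= q <= 1 by rewrite !ltW.
have le1 : \prod_i D i * tail p ^+ r <= (\prod_i P i) `^ c.
  rewrite -prod_powR // -[r in _ ^+ r]card_ord -prodr_const -big_split /=.
  apply: ler_prod => i _; rewrite mulr_ge0 ?divr_ge0 ?ler0n //=.
  apply: le_trans (density_le_biased i p01 kp tp) _.
  by rewrite -{1}qc biased_powR //; exact: upclosure_upward.
(* [Y] is the sum normalised by its largest possible value, and the mean of the [P i] is [Y * q]. As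
   [Y <= 1], its exponent, [r] times [c], can be lowered to 1, which makes the bound linear in the
   sum. *)
pose Y := (\sum_i P i) / (r%:R - 1).
have Y0 : 0 <= Y by rewrite divr_ge0 ?sumr_ge0 // ltW.
have Y1 : Y <= 1 by rewrite ler_pdivrMr // mul1r sum_biased_le.
have le2 : \prod_i P i <= (Y * q) ^+ r.
  have := (@leif_AGM R _ (mem 'I_r) (fun i => P i)).
  rewrite card_ord => /(_ (fun i _ => P0 i)) [le _].
  apply: le_trans le _.
  rewrite (_ : Y * q = (\sum_(i in 'I_r) P i) / r%:R) //.
  by rewrite /Y er; field; rewrite !gt_eqF.
have le3 : (\prod_i P i) `^ c <= Y * p ^+ r.
  apply: (@le_trans _ _ (((Y * q) ^+ r) `^ c)).
    apply: ge0_ler_powR => //; rewrite ?nnegrE; first exact: le_trans ler01 c1.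
      by rewrite prodr_ge0.
    by rewrite exprn_ge0 // mulr_ge0 // ltW.
  rewrite exprMn powRM ?exprn_ge0 ?(ltW q0) //.
  have -> : (q ^+ r) `^ c = p ^+ r.
    by rewrite -powR_mulrn ?(ltW q0) // powRAC qc powR_mulrn // ltW.
  rewrite ler_wpM2r ?exprn_ge0 ?(ltW p0) //.
  have [->|Yn0] := eqVneq Y 0.
    have -> : 0 ^+ r = 0 :> R by rewrite expr0n gtn_eqF // ltnW // ltnW.
    by rewrite powR0 // gt_eqF // (lt_le_trans ltr01).
  have Yr : 0 < Y ^+ r <= 1.
    by rewrite exprn_gt0 ?lt0r ?Yn0 //= exprn_ile1.
  apply: le_trans (ge1r_powR Yr c1) _.
  have -> : Y ^+ r = Y * Y ^+ r.-1 by rewrite -exprS prednK // ltnW // ltnW.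
  by rewrite ler_piMr // exprn_ile1.
have -> : \sum_i P i * p ^+ r = (r%:R - 1) * (Y * p ^+ r).
  by rewrite -big_distrl /Y /= mulrA mulrCA divff ?gt_eqF // mulr1.
by rewrite ler_pM2l //; exact: le_trans le1 le3.
Qed.

End ProductBound.

(** * Stability *)

Section FiniteStability.
Variables (R : realType) (n r k : nat) (A : 'I_r -> {set {set 'I_n}}).
Hypothesis hcross : cross_intersecting A.
Hypothesis r_gt2 : (2 < r)%N.
Hypothesis hA : forall i, A i \subset ksubsets n k.
Hypothesis n_gt0 : (0 < n)%N.
Local Notation q := (r.-1%:R / r%:R : R).
Local Notation x := (k%:R / n%:R : R).
Local Notation tail p := (1 - n%:R * p * (1 - p) / (n%:R * p - k%:R) ^+ 2).

(** The gap between [n%:R * p] and [k] is at least [n%:R * s], and [p * (1 - p) <= 1]. *)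
Lemma tail_ge (s p : R) : 0 < s -> x + s <= p -> p <= 1 ->
  k%:R < n%:R * p /\ 1 - (n%:R * s ^+ 2)^-1 <= tail p.
Proof.
move=> s0 xsp p1; have n0 : 0 < n%:R :> R by rewrite ltr0n.
have x0 : 0 <= x by rewrite divr_ge0.
have ek : k%:R = n%:R * x by rewrite [RHS]mulrCA divff ?mulr1 ?gt_eqF.
have p0 : 0 <= p by lra.
split; first by rewrite ek ltr_pM2l //; lra.
rewrite lerD2l lerN2 ek -mulrBr exprMn.
have px : s <= p - x by lra.
move: (p - x) px => w sw; have w0 : 0 < w by exact: lt_le_trans sw.
have -> : n%:R * p * (1 - p) / (n%:R ^+ 2 * w ^+ 2) = p * (1 - p) * (n%:R * w ^+ 2)^-1.
  by field; rewrite !gt_eqF.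
rewrite -[leRHS]mul1r ler_pM //.
- by rewrite mulr_ge0 // subr_ge0.
- by rewrite invr_ge0 mulr_ge0 ?ler0n // sqr_ge0.
- have : p * p >= 0 by rewrite mulr_ge0.
  by move=> ?; rewrite mulrBr mulr1; lra.
rewrite lef_pV2 ?posrE ?mulr_gt0 ?exprn_gt0 // ler_pM2l //.
by apply: lerXn2r; rewrite ?nnegrE // ltW.
Qed.

(** The constant of [cross_intersecting_stability] for [c0 = a ^+ r / 4], times [r - 1], and doubled
    to absorb a Chebyshev factor of at least one half. *)
Definition stability_constant (a : R) : R :=
  2 * (49 * r%:R ^+ 3 / (a ^+ r / 4) ^+ 2 * (r%:R - 1)).

Lemma finite_stability (a s d : R) :
    0 < a -> a <= x -> 0 < s -> x + s <= q -> 0 <= d <= 2^-1 ->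
    (n%:R * s ^+ 2)^-1 <= 2^-1 ->
    (1 - d) * x ^+ r <= \prod_i (#|A i|%:R / 'C(n, k)%:R) ->
  exists j : 'I_n, forall i, #|A i :\: star n k j|%:R / 'C(n, k)%:R
    <= stability_constant a * (d + r%:R * (s / a + (n%:R * s ^+ 2)^-1)).
Proof.
move=> a0 ax s0 xsq /andP[d0 d12]; set v := (_ * _)^-1 => v12 hprod.
have n0 : 0 < n%:R :> R by rewrite ltr0n.
have r0 : 0 < r%:R :> R by rewrite ltr0n ltnW // ltnW.
have q1 : q <= 1 by rewrite ler_pdivrMr // mul1r ler_nat leq_pred.
have v0 : 0 <= v by rewrite invr_ge0 mulr_ge0 ?ler0n // sqr_ge0.
have x0 : 0 < x by exact: lt_le_trans ax.
have kn : (k <= n)%N.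
  have : x <= 1 by lra.
  by rewrite ler_pdivrMr // mul1r ler_nat.
have [kq tq] : k%:R < n%:R * q /\ 1 - v <= tail q by exact: tail_ge.
have [kp tp] : k%:R < n%:R * (x + s) /\ 1 - v <= tail (x + s).
  by apply: tail_ge => //; lra.
pose D i : R := #|A i|%:R / 'C(n, k)%:R.
have C_gt0 : 0 < 'C(n, k)%:R :> R by rewrite ltr0n bin_gt0.
have D01 i : 0 <= D i <= 1.
  rewrite divr_ge0 ?ler0n //= ler_pdivrMr // mul1r ler_nat.
  apply: leq_trans (subset_leq_card (hA i)) _.
  by rewrite card_draws card_ord.
(* The other densities are at most 1, so each one is at least the whole product. Multiplying by
   [tail q], which is at least one half, gives the [a ^+ r / 4] of [P_ge]. *)
have D_ge i : a ^+ r / 2 <= D i.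
  apply: (@le_trans _ _ ((1 - d) * x ^+ r)).
    rewrite mulrC; apply: ler_pM; rewrite ?invr_ge0 ?exprn_ge0 ?(ltW a0) //; first lra.
    by apply: lerXn2r => //; rewrite ?nnegrE ltW.
  apply: le_trans hprod _; rewrite (bigD1 i) //= -/(D i) ler_piMr //.
    by case/andP: (D01 i).
  by apply: Num.Theory.prodr_ile1 => l _; exact: D01.
have P_ge i : a ^+ r / 4 <= biased q (upclosure (A i)).
  have q01 : 0 <= q <= 1 by rewrite divr_ge0 //.
  have tq0 : 0 <= tail q by apply: le_trans tq; lra.
  apply: le_trans (density_le_biased kn hA i q01 kq tq0).
  rewrite (_ : a ^+ r / 4 = a ^+ r / 2 * 2^-1); last by field.
  apply: ler_pM; rewrite ?divr_ge0 ?exprn_ge0 ?(ltW a0) //; first exact: D_ge.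
  by apply: le_trans tq; lra.
have ar0 : 0 < a ^+ r / 4 by rewrite divr_gt0 // exprn_gt0.
have [j hj] := cross_intersecting_stability hcross r_gt2 n_gt0 kn hA ar0 P_ge kq.
exists j => i; set e := _ / _.
have e0 : 0 <= e by rewrite divr_ge0.
have := hj i; rewrite -/e; set S := \sum_i _ => he.
set K := 49 * _ / _ in he; have eK : stability_constant a = 2 * (K * (r%:R - 1)) by [].
have K0 : 0 <= K by rewrite divr_ge0 // ?mulr_ge0 ?exprn_ge0 // ltW.
clearbody K.
have r1 : 0 <= r%:R - 1 :> R by rewrite subr_ge0 ler1n ltnW // ltnW.
suff hS : r%:R - 1 - S <= (r%:R - 1) * (d + r%:R * (s / a + v)).
  rewrite eK.
  have : e * 2^-1 <= e * tail q by rewrite ler_wpM2l //; apply: le_trans tq; lra.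
  have := ler_wpM2l K0 hS.
  move: he; move: (e * tail q) => E he le1 le2.
  have : e <= 2 * (K * (r%:R - 1 - S)) by lra.
  lra.
pose p := x + s; have p0 : 0 < p by rewrite addr_gt0.
have pq : 0 < p <= q by rewrite p0.
have tp0 : 0 <= tail p by apply: le_trans tp; lra.
have := prod_density_le hcross r_gt2 kn hA pq kp tp0.
rewrite -big_distrl -/S /= => hP.
move: (tail p) tp tp0 hP => tl tp tp0 hP; clear kq tq kp hj he D_ge P_ge.
(* [1 - u] is the loss per factor: [x / p] for raising the bias from [x] to [p = x + s], and [1 - v]
   for Chebyshev. Bernoulli bounds the total loss over [r] factors. *)
pose u := 1 - x / p * (1 - v).
have xp : x / p = 1 - s / p by rewrite -[x](addrK s) -/p mulrBl divff // gt_eqF.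
have sp : 0 <= s / p <= s / a.
  apply/andP; split; first by rewrite divr_ge0 // ltW.
  by rewrite ler_pM2l // lef_pV2 ?posrE // /p; lra.
have u01 : 0 <= u <= 1.
  have : 0 <= x / p * (1 - v) <= 1; last by rewrite /u; lra.
  rewrite xp mulr_ge0 /=; [|by rewrite -xp divr_ge0 ?ltW|lra].
  by rewrite -[leRHS]mul1r ler_pM //; first (rewrite -xp divr_ge0 ?ltW //); lra.
have uu : u <= s / a + v.
  rewrite /u xp; move: (s / p) (s / a) sp => y z yz.
  have : 0 <= y * v by rewrite mulr_ge0 //; lra.
  lra.
have hw := expr_1sub_ge r u01; set w := (1 - u) ^+ r in hw.
have w0 : 0 <= w by rewrite exprn_ge0 //; lra.
have w1 : w <= 1 by rewrite exprn_ile1 //; lra.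
have ew : w = x ^+ r * (1 - v) ^+ r / p ^+ r.
  by rewrite /w /u subKr exprMn exprMn exprVn mulrAC.
have hS : (r%:R - 1) * ((1 - d) * w) <= S.
  have pr0 : 0 < p ^+ r by rewrite exprn_gt0.
  rewrite -(ler_pM2r pr0) ew; apply: le_trans hP.
  have -> (c1 c2 X Z : R) : c1 * (c2 * (X * Z / p ^+ r)) * p ^+ r = c1 * (c2 * X * Z).
    by rewrite !mulrA divfK ?gt_eqF.
  rewrite ler_wpM2l //.
  apply: ler_pM => //.
  - by rewrite mulr_ge0 ?exprn_ge0 ?(ltW x0) //; lra.
  - by rewrite exprn_ge0 //; lra.
  by apply: lerXn2r => //; rewrite ?nnegrE; lra.
rewrite -[X in X - S]mulr1 lerBlDr; apply: le_trans (lerD (lexx _) hS).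
rewrite -mulrDr ler_wpM2l //.
have dw : d * w <= d * 1 by rewrite ler_wpM2l.
have ru : r%:R * u <= r%:R * (s / a + v) by rewrite ler_wpM2l // ltW.
clear -hw dw ru; clearbody w u; move: (s / a + v) ru => z ru; lra.
Qed.

End FiniteStability.

Theorem corollary5p2 (R : realType) (r : nat) (a b : R) (k : nat -> nat)
    (A : forall n : nat, 'I_r -> {set {set 'I_n}}) (eps : nat -> R)
    (hr : (3 <= r)%N)
    (ha : 0 < a) (hab : a < b) (hb : b < (r%:R - 1) / r%:R)
    (hk : \forall n \near \oo, a <= (k n)%:R / n%:R <= b)
    (hA : forall (n : nat) (i : 'I_r), A n i \subset ksubsets n (k n))
    (hcross : forall n : nat, cross_intersecting (A n))
    (heps : eps n @[n --> \oo] --> (0 : R))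
    (hprod : \forall n \near \oo,
      (1 - eps n) * ((k n)%:R / n%:R) ^+ r
        <= \prod_(i < r) (#|A n i|%:R / 'C(n, k n)%:R)) :
  exists j : nat -> nat,
    (forall n : nat, (0 < n)%N -> (j n < n)%N) /\
    forall i : 'I_r,
      (#|symdiff (A n i) (star n (k n) (j n))|%:R / 'C(n.-1, (k n).-1)%:R : R)
        @[n --> \oo] --> (0 : R).
Proof.
(* The sequence [j] must be fixed before the accuracy is. Taking [j n] to minimise the total
   distance makes it at least as good as any star found later for a given accuracy. *)
pose total n m := (\sum_i #|symdiff (A n i) (star n (k n) m)|)%N.
have /choice[j hj] : forall n, exists j : nat,
    ((0 < n)%N -> (j < n)%N) /\ forall m : 'I_n, (total n j <= total n m)%N.
  case=> [|n].
    by exists 0%N; split => // -[].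
  case: (@arg_minnP _ (ord0 : 'I_n.+1) xpredT (fun m : 'I_n.+1 => total n.+1 m) isT).
  by move=> m _ mmin; exists m; split => // m'; exact: mmin.
exists j; split=> [n|i]; first exact: (hj n).1.
have r0 : 0 < r%:R :> R by rewrite ltr0n ltnW // ltnW.
have eq_q : r.-1%:R = r%:R - 1 :> R by rewrite -subn1 natrB // ltnW // ltnW.
have hbq : b < r.-1%:R / r%:R by rewrite eq_q.
pose K := stability_constant r a.
have K0 : 0 < K.
  have r1 : 0 < r%:R - 1 :> R by rewrite subr_gt0 ltr1n ltnW.
  rewrite /K /stability_constant; apply: mulr_gt0 => //; apply: mulr_gt0 => //.
  by apply: divr_gt0; rewrite ?mulr_gt0 ?exprn_gt0 // divr_gt0 ?exprn_gt0.
apply/cvgrPdist_lt => e e0.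
(* With [e] and [d] at most [th], the bound of [symdiff_star_le] is at most [L * th]; [th] makes the
   [r] families contribute [e / 2] together. *)
pose L := (3 + r%:R / a) / a.
have L0 : 0 < L by rewrite divr_gt0 // addr_gt0 // divr_gt0.
pose th := e / (2 * r%:R * L).
have th0 : 0 < th by apply: divr_gt0 => //; apply: mulr_gt0 => //; exact: mulr_gt0.
have rLth : r%:R * (L * th) = e / 2 by rewrite /th; field; rewrite !gt_eqF.
clearbody th.
(* [s], [mu] and [nu] keep each of the three error terms of [finite_stability] below [th / 3]; [s]
   also leaves room for [b + s] below [q]. *)
pose s := Num.min (r.-1%:R / r%:R - b) (th * a / (3 * K * r%:R)).
have K3r : 0 < 3 * K * r%:R by apply: mulr_gt0 => //; exact: mulr_gt0.
have K3 : 0 < 3 * K by exact: mulr_gt0.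
have s0 : 0 < s by rewrite lt_min subr_gt0 hbq divr_gt0 // mulr_gt0.
have sq : s <= r.-1%:R / r%:R - b by rewrite ge_min lexx.
have sth : K * r%:R * (s / a) <= th / 3.
  have : s <= th * a / (3 * K * r%:R) by rewrite ge_min lexx orbT.
  rewrite ler_pdivlMr // => hs.
  by rewrite mulrA ler_pdivrMr //; lra.
pose mu := Num.min (th / (3 * K)) (Num.min th 2^-1).
have mu0 : 0 < mu by rewrite !lt_min th0 divr_gt0 //= invr_gt0.
pose nu := Num.min (th / (3 * K * r%:R)) 2^-1.
have nu0 : 0 < nu by rewrite lt_min divr_gt0 //= invr_gt0.
have heps0 : \forall n \near \oo, `|eps n| < mu.
  by move/cvgr0Pnorm_lt : heps => /(_ mu mu0).
near=> n.
have n_gt0 : (0 < n)%N by near: n; exact: nbhs_infty_gt.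
have n0 : 0 < n%:R :> R by rewrite ltr0n.
have /andP[ax xb] : a <= (k n)%:R / n%:R <= b by near: n.
have hpn : (1 - eps n) * ((k n)%:R / n%:R) ^+ r
    <= \prod_(i < r) (#|A n i|%:R / 'C(n, k n)%:R) by near: n.
have epsn : `|eps n| < mu by near: n.
have n_big : (s ^+ 2 * nu)^-1 <= n%:R by near: n; exact: nbhs_infty_ger.
have hv : (n%:R * s ^+ 2)^-1 <= nu.
  rewrite invf_ple ?posrE ?mulr_gt0 ?exprn_gt0 //.
  by move: n_big; rewrite invfM mulrC ler_pdivrMr ?exprn_gt0.
(* [eps n] may be negative; its absolute value gives a nonnegative [d] and only weakens the lower
   bound. *)
set d := `|eps n| in epsn.
have x0 : 0 < (k n)%:R / n%:R :> R by exact: lt_le_trans ax.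
have hpd : (1 - d) * ((k n)%:R / n%:R) ^+ r
    <= \prod_(i < r) (#|A n i|%:R / 'C(n, k n)%:R).
  by apply: le_trans hpn; rewrite ler_wpM2r ?exprn_ge0 ?(ltW x0) // lerD2l lerN2 ler_norm.
have d0 : 0 <= d by exact: normr_ge0.
have [d1 d2 d3] : [/\ d <= th / (3 * K), d <= th & d <= 2^-1].
  by move: (ltW epsn); rewrite !le_min => /and3P[].
have [v1 v2] : (n%:R * s ^+ 2)^-1 <= th / (3 * K * r%:R) /\ (n%:R * s ^+ 2)^-1 <= 2^-1.
  by move: hv; rewrite le_min => /andP[].
have xsq : (k n)%:R / n%:R + s <= r.-1%:R / r%:R by lra.
have d01 : 0 <= d <= 2^-1 by rewrite d0.
have [j' hj'] := finite_stability (hcross n) hr (hA n) n_gt0 ha ax s0 xsq d01 v2 hpd.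
have hth l : #|A n l :\: star n (k n) j'|%:R / 'C(n, k n)%:R <= th.
  apply: le_trans (hj' l) _; rewrite -/K.
  move: d1 v1; rewrite !ler_pdivlMr //; move: sth.
  move: (s / a) ((n%:R * s ^+ 2)^-1) => y v; clearbody K d; clear; lra.
have k_gt0 : (0 < k n)%N.
  by rewrite lt0n; apply: contraTneq x0 => ->; rewrite mul0r ltxx.
have q1 : r.-1%:R / r%:R <= 1 :> R by rewrite ler_pdivrMr // mul1r ler_nat leq_pred.
have kn : (k n <= n)%N.
  have : (k n)%:R / n%:R <= 1 :> R by lra.
  by rewrite ler_pdivrMr // mul1r ler_nat.
have hsd := symdiff_star_le (j := j') k_gt0 kn ha (ltW th0) d0 ax hpd hth.
have C0 : 0 < 'C(n.-1, (k n).-1)%:R :> R.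
  by rewrite ltr0n bin_gt0 -!subn1 leq_sub2r.
rewrite sub0r normrN ger0_norm ?divr_ge0 //.
apply: (@le_lt_trans _ _ ((total n j')%:R / 'C(n.-1, (k n).-1)%:R)).
  rewrite ler_pM2r ?invr_gt0 // ler_nat; apply: leq_trans ((hj n).2 j').
  by rewrite /total (bigD1 i) //= leq_addr.
rewrite /total natr_sum big_distrl /=.
apply: (@le_lt_trans _ _ (\sum_(l < r) L * th)).
  apply: ler_sum => l _; apply: le_trans (hsd l) _.
  have -> : L * th = (3 * th + r%:R * th / a) / a by rewrite /L; field; rewrite gt_eqF.
  rewrite ler_pM2r ?invr_gt0 // lerD2r.
  by clear -d2; lra.
rewrite sumr_const card_ord -[_ *+ r]mulr_natl.
by rewrite rLth; lra.
Unshelve. all: by end_near.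
Qed.
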